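(* Let $\varphi\in L^2(\mathbb{R})$ be such that $\Phi_\varphi$ has singularities only at finitely many points $X=\{x_1,\dots,x_s\}\subset\mathbb{T}$ (distinct points), the order of the singularity at $x_j$ being $\lambda_j\in\mathbb{N}$, $1\le j\le s$. Put $|\Lambda|=\sum_{j=1}^s\lambda_j$ and assume $|\Lambda|\ge1$. Let $\Omega\subset\mathbb{Z}$ be a set of $|\Lambda|$ consecutive integers and $\Omega^c=\mathbb{Z}\setminus\Omega$. Then the system $\{\varphi(\cdot+k)\}_{k\in\Omega^c}$ is not a (Schauder) basis in $S(\varphi)$ for any enumeration.
   Context: $\mathbb{T}=\mathbb{R}/\mathbb{Z}$, $\mathbb{N}=\{1,2,\dots\}$. The Fourier transform on $L^2(\mathbb{R})$ is the isometry given for $f\in L^1(\mathbb{R})\cap L^2(\mathbb{R})$ by $\widehat f(y)=\int_{\mathbb{R}}f(x)e^{-2\pi ixy}\,dx$. For $\varphi\in L^2(\mathbb{R})$, $\Phi_\varphi(t)=\sum_{k\in\mathbb{Z}}|\widehat\varphi(t+k)|^2$, a $1$-periodic nonnegative function in $L^1(\mathbb{T})$. $S(\varphi)$ is the closed linear span in $L^2(\mathbb{R})$ of $\{\varphi(\cdot+k):k\in\mathbb{Z}\}$. Singularities: a nonnegative measurable function $w$ on $\mathbb{R}$ has a singularity of order $k\in\mathbb{N}$ at $x_0\in\mathbb{R}$ if there is a (bounded open) interval $I$ centered at $x_0$ such that $\frac{(x-x_0)^{2(k-1)}}{w(x)}\notin L^1(I)$ but $\frac{(x-x_0)^{2k}}{w(x)}\in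 L^1(I)$. For the periodic function $\Phi_\varphi$, points of $\mathbb{T}$ are identified with their representatives in $\mathbb{R}$. ''Singularities only at the points of $X$'' means that $1/\Phi_\varphi$ is integrable in a neighbourhood of every point of $\mathbb{T}\setminus X$. *)

(* Defs.v *)
From HB Require Import structures.
From mathcomp Require Export all_boot all_order all_algebra.
From mathcomp Require Export all_classical all_reals all_analysis.
From mathcomp Require Export complex.
Export Order.TTheory GRing.Theory Num.Theory.
Export numFieldNormedType.Exports.

Set Implicit Arguments.
Unset Strict Implicit.
Unset Printing Implicit Defensive.

Local Open Scope classical_set_scope.
Local Open Scope ring_scope.

(* Complex-valued functions on the line. Elements of $L^p(\mathbb{R})$ are
   Borel representatives; equality in $L^2$ is vanishing of the $L^2$-distance,
   i.e. equality almost everywhere. *)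
Section ComplexLp.
Variable R : realType.
Implicit Types f g : R -> R[i].

Local Notation mu := (@lebesgue_measure R).

Definition Cmeasurable f : Prop :=
  measurable_fun [set: R] (fun x => complex.Re (f x)) /\
  measurable_fun [set: R] (fun x => complex.Im (f x)).

Definition CLnorm (p : \bar R) f : \bar R :=
  Lnorm mu p (fun x => (Normc.normc (f x))%:E).

Definition CLp (p : \bar R) : set (R -> R[i]) :=
  [set f | Cmeasurable f /\ (CLnorm p f < +oo)%E].

Definition L2dist f g : \bar R := CLnorm 2%:E (fun x => f x - g x).

Definition Cintegral f : R[i] :=
  Complex (\int[mu]_x complex.Re (f x)) (\int[mu]_x complex.Im (f x)).

(* $e^{i\theta}$ *)
Definition Cexpi (theta : R) : R[i] := Complex (cos theta) (sin theta).

Definition fourier_integral f (y : R) : R[i] :=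
  Cintegral (fun x => f x * Cexpi (- (2 * pi * x * y))).

(* [F] is the Fourier transform on $L^2(\mathbb{R})$: the isometry of
   $L^2(\mathbb{R})$ given on $L^1\cap L^2$ by the Fourier integral.
   As $L^1\cap L^2$ is dense, this determines [F] on $L^2(\mathbb{R})$ up to
   equality almost everywhere. *)
Definition is_L2_fourier (F : (R -> R[i]) -> (R -> R[i])) : Prop :=
  [/\ forall f, CLp 2%:E f -> CLp 2%:E (F f),
      forall f g, CLp 2%:E f -> CLp 2%:E g -> L2dist (F f) (F g) = L2dist f g
    & forall f, CLp 1%:E f -> CLp 2%:E f ->
        {ae mu, forall y, F f y = fourier_integral f y}].

(* $\Phi_\varphi(t)=\sum_{k\in\mathbb{Z}}|\widehat\varphi(t+k)|^2$, where [phihat]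
   is $\widehat\varphi$; the value may be $+\infty$ on a null set. *)
Definition periodization (phihat : R -> R[i]) (t : R) : \bar R :=
  \esum_(k in [set: int]) (Normc.normc (phihat (t + k%:~R)) ^+ 2)%:E.

Definition translate (phi : R -> R[i]) (k : int) : R -> R[i] :=
  fun x => phi (x + k%:~R).

(* $S(\varphi)$ *)
Definition closed_span_translates (phi : R -> R[i]) : set (R -> R[i]) :=
  [set f | CLp 2%:E f /\
     forall e : R, 0 < e -> exists (s : seq int) (c : int -> R[i]),
       (L2dist f (fun x => (\sum_(k <- s) c k * translate phi k x)%R) < e%:E)%E].

(* Coefficient sequences are compared by Leibniz equality, functions in $L^2$. *)
Definition schauder_basis (S : set (R -> R[i])) (e : nat -> R -> R[i]) : Prop :=
  (forall n, S (e n)) /\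
  forall f, S f -> exists! c : nat -> R[i],
    L2dist f (fun x => (\sum_(n < N) c n * e n x)%R) @[N --> \oo] --> 0%E.

End ComplexLp.

Section Singularities.
Variable R : realType.

Local Notation mu := (@lebesgue_measure R).

Definition centered (x0 r : R) : set R := `]x0 - r, x0 + r[.

(* The quotients are extended-real: $1/0=+\infty$ and $1/{+\infty}=0$. *)
Definition has_singularity (w : R -> \bar R) (k : nat) (x0 : R) : Prop :=
  (1 <= k)%N /\ exists r : R, [/\ 0 < r,
    ~ mu.-integrable (centered x0 r)
        (fun x => ((x - x0) ^+ (2 * (k - 1)))%:E / w x)%E
    & mu.-integrable (centered x0 r)
        (fun x => ((x - x0) ^+ (2 * k))%:E / w x)%E].

Definition locally_integrable_at (h : R -> \bar R) (x0 : R) : Prop :=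
  exists2 r : R, 0 < r & mu.-integrable (centered x0 r) h.

End Singularities.

Definition consecutive_integers (Omega : set int) (n : nat) : Prop :=
  exists m : int, Omega = [set k | (m <= k < m + n%:Z)%R].

(* Main.v *)
Require Import Defs.
From mathcomp Require Import ring lra zify measurable_realfun.

(** Write E_k(t) = e^{2 pi i k t} and let Phi be the periodization of |F phi|^2.
    Since F is an isometry intertwining translations with multiplication by
    the E_k, the norm of sum d_k phi(. + k) is that of sum d_k E_k in
    L^2([0,1), Phi).  (Squared norms are used throughout; the factors 2 lost in
    |a + b|^2 <= 2 |a|^2 + 2 |b|^2 are harmless.)

    Pick m in Omega and suppose phi(. + m) = sum_n c_n phi(. + sigma n).  The
    translates have equal norms, nonzero by uniqueness of expansions, so
    c_n -> 0.  Let d be the sequence on the integers with d_m = 1,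
    d_(sigma n) = - c_n and d = 0 elsewhere, so that the partial sums of
    sum d_k E_k tend to 0 in L^2(Phi).  With w_j = E_{-1}(x_j), the test function
      h = E_{-a} prod_j (E_{-1} - w_j)^(lambda_j)
    vanishes at x_j to order lambda_j, hence |h|^2 / Phi is integrable and pairing
    with h is continuous on L^2(Phi).  By orthogonality of the E_k the limit of
    the pairings is the iterated difference prod_j (S - w_j)^(lambda_j) d at a,
    S being the shift, which is therefore 0 for every a.  As |w_j| = 1 and
    d -> 0 at +oo, the only such sequence is d = 0, contradicting d_m = 1. *)

Set Implicit Arguments.
Unset Strict Implicit.
Unset Printing Implicit Defensive.

Local Open Scope classical_set_scope.
Local Open Scope ring_scope.

(** * Iterated differences *)

Section Difference.
Variable R : realType.
Implicit Types (ws : seq R[i]) (d : int -> R[i]).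

Lemma normc_ge0 (z : R[i]) : 0 <= Normc.normc z.
Proof. by case: z => a b; exact: sqrtr_ge0. Qed.

(** The operator [prod_(w <- ws) (S - w)] applied to [d], where [S] is the shift
    [(S d) a = d (a + 1)]. *)
Fixpoint difference ws d (a : int) : R[i] :=
  if ws is w :: ws' then difference ws' d (a + 1) - w * difference ws' d a
  else d a.

Definition vanishes_at_pinfty d : Prop :=
  forall e : R, 0 < e -> exists K : int, forall k, K <= k -> Normc.normc (d k) < e.

(** An iterated difference at [a] reads only the finitely many values at [a, ..., a + size ws], so
    pointwise stabilization passes to it. *)
Lemma difference_eventually_eq ws (D : nat -> int -> R[i]) d :
    (forall a, exists N0 : nat, forall N, (N0 <= N)%N -> D N a = d a) ->
  forall a, exists N0 : nat, forall N, (N0 <= N)%N ->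
    difference ws (D N) a = difference ws d a.
Proof.
move=> Dd; elim: ws => [//|w ws IH] a /=.
have [N1 h1] := IH (a + 1); have [N2 h2] := IH a.
exists (maxn N1 N2) => N; rewrite geq_max => /andP[/h1 -> /h2 ->].
by [].
Qed.

(** Each factor [S - w] enlarges a bound on the tail by at most [1 + |w|], hence the tolerance
    [e / (1 + |w|)]. *)
Lemma difference_vanishes ws d :
  vanishes_at_pinfty d -> vanishes_at_pinfty (difference ws d).
Proof.
move=> d0; elim: ws => [//|w ws IH] e e0 /=.
have w0 : 0 < 1 + Normc.normc w.
  by rewrite ltr_wpDr// normc_ge0.
have [K hK] := IH (e / (1 + Normc.normc w)) (divr_gt0 e0 w0).
exists K => k Kk.
apply: (le_lt_trans (le_normcD _ _)).
rewrite normcN Normc.normcM.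
have {}h1 := hK (k + 1) (ler_wpDr ler01 Kk).
have h2 := hK k Kk.
rewrite -[ltRHS](divfK (lt0r_neq0 w0)) mulrDr mulr1.
rewrite ltr_leD// mulrC ler_wpM2r ?normc_ge0// ltW//.
Qed.

(* A geometric sequence of ratio w has constant modulus when |w| = 1. *)
Lemma difference_eq0 ws d : {in ws, forall w, Normc.normc w = 1} ->
  vanishes_at_pinfty d -> (forall a, difference ws d a = 0) -> forall a, d a = 0.
Proof.
move=> ws1 d0; elim: ws ws1 => [//|w ws IH] ws1 /= h.
apply: IH => [v vws|]; first by apply: ws1; rewrite inE vws orbT.
set g := difference ws d.
have gS a : g (a + 1) = w * g a by apply/eqP; rewrite -subr_eq0 h.
have gN a (n : nat) : Normc.normc (g (a + n%:Z)) = Normc.normc (g a).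
  elim: n => [|n ihn]; first by rewrite addr0.
  by rewrite -addn1 PoszD addrA gS Normc.normcM ihn ws1 ?mul1r// mem_head.
move=> a; apply: Normc.eq0_normc; apply/eqP.
rewrite eq_le normc_ge0 andbT leNgt; apply/negP => ga0.
(* The tolerance is [|g a|] itself: moving right from [a] by [|K - a|] passes [K] without changing
   the modulus. *)
have [K hK] := difference_vanishes ws d0 ga0.
have := hK (a + (absz (K - a))%:Z).
rewrite -/g gN ltxx.
have Ka : K <= a + (absz (K - a))%:Z by lia.
by move/(_ Ka).
Qed.

End Difference.

(** * Squared norms of complex-valued functions *)

Section Energy.
Variable R : realType.
Local Notation mu := (@lebesgue_measure R).
Implicit Types (f g : R -> R[i]) (z w : R[i]).

(** The squared modulus as a polynomial in the real and imaginary parts, so that measurability and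
    algebraic bounds involve no square root. *)
Definition sqn z : R := complex.Re z ^+ 2 + complex.Im z ^+ 2.

Lemma sqn_normc z : Normc.normc z ^+ 2 = sqn z.
Proof. by case: z => a b; rewrite /sqn /= sqr_sqrtr// addr_ge0// sqr_ge0. Qed.

Lemma sqn_ge0 z : 0 <= sqn z.
Proof. by rewrite addr_ge0// sqr_ge0. Qed.

Lemma sqnM z w : sqn (z * w) = sqn z * sqn w.
Proof. by case: z w => [a b] [c d]; rewrite /sqn /=; ring. Qed.

Lemma sqnN z : sqn (- z) = sqn z.
Proof. by case: z => [a b]; rewrite /sqn /= !sqrrN. Qed.

Lemma sqn0 : sqn 0 = 0.
Proof. by rewrite /sqn /= expr0n addr0. Qed.

(** By the parallelogram identity the two sides differ by [|z - w|^2]. *)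
Lemma sqnD z w : sqn (z + w) <= 2 * sqn z + 2 * sqn w.
Proof.
case: z w => [a b] [c d]; rewrite /sqn /=.
have := sqr_ge0 (a - c); have := sqr_ge0 (b - d); nra.
Qed.

Definition energy f : \bar R := \int[mu]_x (sqn (f x))%:E.

Lemma energy_ge0 f : (0 <= energy f)%E.
Proof. by apply: integral_ge0 => t _; rewrite lee_fin sqn_ge0. Qed.

Lemma CLnorm2E f : CLnorm 2%:E f = (energy f `^ 2^-1)%E.
Proof.
rewrite /CLnorm unlock /energy; congr (_ `^ _)%E; apply: eq_integral => t _.
by rewrite gee0_abs ?lee_fin ?normc_ge0// poweR_EFin powR_mulrn ?normc_ge0// sqn_normc.
Qed.

Lemma measurable_sqn f : Cmeasurable f -> measurable_fun [set: R] (fun x => sqn (f x)).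
Proof.
by move=> [mr mi]; apply: measurable_funD; exact: measurable_funX.
Qed.

Lemma CmeasurableD f g : Cmeasurable f -> Cmeasurable g ->
  Cmeasurable (fun x => f x + g x).
Proof.
move=> [fr fi] [gr gi]; split.
- by under eq_fun do rewrite raddfD; exact: measurable_funD.
- by under eq_fun do rewrite raddfD; exact: measurable_funD.
Qed.

Lemma CmeasurableN f : Cmeasurable f -> Cmeasurable (fun x => - f x).
Proof.
move=> [fr fi]; split.
- by under eq_fun do rewrite raddfN; exact: measurableT_comp.
- by under eq_fun do rewrite raddfN; exact: measurableT_comp.
Qed.

Lemma ReM z w : complex.Re (z * w) =
  complex.Re z * complex.Re w - complex.Im z * complex.Im w.
Proof. by case: z w => [a b] [c d]. Qed.

Lemma ImM z w : complex.Im (z * w) =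
  complex.Re z * complex.Im w + complex.Im z * complex.Re w.
Proof. by case: z w => [a b] [c d]. Qed.

Lemma CmeasurableM f g : Cmeasurable f -> Cmeasurable g ->
  Cmeasurable (fun x => f x * g x).
Proof.
move=> [fr fi] [gr gi]; split.
- under eq_fun do rewrite ReM.
  by apply: measurable_funB; exact: measurable_funM.
- under eq_fun do rewrite ImM.
  by apply: measurable_funD; exact: measurable_funM.
Qed.

Lemma Cmeasurable_cst z : Cmeasurable (fun _ : R => z).
Proof. by split; exact: measurable_cst. Qed.

Lemma Cmeasurable_sum (I : Type) (l : seq I) (u : I -> R -> R[i]) :
  (forall i, Cmeasurable (u i)) -> Cmeasurable (fun x => \sum_(i <- l) u i x).
Proof.
move=> mu_; elim: l => [|i l IH].
  by under eq_fun do rewrite big_nil; exact: Cmeasurable_cst.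
by under eq_fun do rewrite big_cons; exact: CmeasurableD.
Qed.

Lemma energyD f g : Cmeasurable f -> Cmeasurable g ->
  (energy (fun x => (f x + g x)%R) <= 2%:E * energy f + 2%:E * energy g)%E.
Proof.
move=> mf mg; rewrite /energy -!ge0_integralZl_EFin//; last 4 first.
- by move=> t _; rewrite lee_fin sqn_ge0.
- by apply/measurable_EFinP; exact: measurable_sqn.
- by move=> t _; rewrite lee_fin sqn_ge0.
- by apply/measurable_EFinP; exact: measurable_sqn.
rewrite -ge0_integralD//; last 4 first.
- by move=> t _; rewrite -EFinM lee_fin mulr_ge0 ?sqn_ge0.
- by apply/measurable_EFinP; apply: measurable_funM => //; exact: measurable_sqn.
- by move=> t _; rewrite -EFinM lee_fin mulr_ge0 ?sqn_ge0.
- by apply/measurable_EFinP; apply: measurable_funM => //; exact: measurable_sqn.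
apply: ge0_le_integral => //.
- by move=> t _; rewrite lee_fin sqn_ge0.
- by apply/measurable_EFinP; apply: measurable_sqn; exact: CmeasurableD.
- apply/measurable_EFinP; apply: measurable_funD; apply: measurable_funM => //;
    exact: measurable_sqn.
- by move=> t _; rewrite -!EFinM -EFinD lee_fin sqnD.
Qed.

Lemma energyM_le (p f : R -> R[i]) (C : R) : Cmeasurable p -> Cmeasurable f -> 0 <= C ->
  (forall x, sqn (p x) <= C) -> (energy (fun x => (p x * f x)%R) <= C%:E * energy f)%E.
Proof.
move=> mp mf C0 pC; rewrite /energy -ge0_integralZl_EFin//; last 2 first.
- by move=> t _; rewrite lee_fin sqn_ge0.
- by apply/measurable_EFinP; exact: measurable_sqn.
apply: ge0_le_integral => //.
- by move=> t _; rewrite lee_fin sqn_ge0.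
- by apply/measurable_EFinP; apply: measurable_sqn; exact: CmeasurableM.
- by apply/measurable_EFinP; apply: measurable_funM => //; exact: measurable_sqn.
- by move=> t _; rewrite -EFinM lee_fin sqnM ler_wpM2r ?sqn_ge0.
Qed.

Lemma energyZ z f : Cmeasurable f ->
  energy (fun x => z * f x) = ((sqn z)%:E * energy f)%E.
Proof.
move=> mf; rewrite /energy -ge0_integralZl_EFin ?sqn_ge0//; last 2 first.
- by move=> t _; rewrite lee_fin sqn_ge0.
- by apply/measurable_EFinP; exact: measurable_sqn.
by apply: eq_integral => t _; rewrite sqnM.
Qed.

Lemma CLp2P f : CLp 2%:E f <-> Cmeasurable f /\ (energy f < +oo)%E.
Proof.
rewrite /CLp /= CLnorm2E; split=> -[mf h]; split=> //.
- by apply: lty_poweRy h; rewrite invr_neq0.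
- exact: poweR_lty.
Qed.

End Energy.

(** * Translation and the Fourier transform *)

Section Translation.
Variable R : realType.
Local Notation mu := (@lebesgue_measure R).

Definition shiftby (c : R) : R -> measurableTypeR R := fun x => x + c.

Lemma measurable_shiftby (c : R) : measurable_fun [set: R] (shiftby c).
Proof. by apply: measurable_funD. Qed.

(** Lebesgue measure is determined by its values on half-open intervals, and a shift preserves their
    lengths. *)
Lemma lebesgue_measure_shift (c : R) (A : set R) : measurable A ->
  pushforward mu (shiftby c) A = mu A.
Proof.
move=> mA; apply/esym/lebesgue_measure_unique => //=.
  exact: measurable_shiftby.
move=> _ _ [[a b]] _ <-.
rewrite /pushforward.
rewrite (_ : shiftby c @^-1` _ = `]a - c, b - c]%classic); last first.
  by apply/seteqP; split=> t /=; rewrite /shiftby !in_itv/= ltrBlDr lerBrDr.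
rewrite !lebesgue_measure_itv/= !lte_fin ltrD2r; case: ifP => // _.
by rewrite -!EFinB; congr EFin; ring.
Qed.

Lemma ge0_integral_shift (c : R) (D : set R) (f : R -> \bar R) : measurable D ->
  measurable_fun D f -> (forall x, D x -> (0 <= f x)%E) ->
  (\int[mu]_(x in D) f x = \int[mu]_(x in [set x | D (x + c)%R]) f (x + c)%R)%E.
Proof.
move=> mD mf f0.
transitivity (\int[pushforward mu (shiftby c)]_(x in D) f x)%E.
  apply: eq_measure_integral; first exact: measurable_shiftby.
  by move=> mphi A mA _; exact/esym/lebesgue_measure_shift.
rewrite ge0_integral_pushforward//; first exact: measurable_shiftby.
by move=> t /set_mem; exact: f0.
Qed.

Lemma integral_shift (c : R) (f : R -> \bar R) : measurable_fun [set: R] f ->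
  (\int[mu]_x f x = \int[mu]_x f (x + c)%R)%E.
Proof.
move=> mf; rewrite integralE [RHS]integralE; congr (_ - _)%E.
- transitivity (\int[mu]_(x in [set x | setT (x + c)%R]) f^\+ (x + c)%R)%E; last first.
    by apply: eq_integral => t _; rewrite !funeposE.
  by apply: ge0_integral_shift => //; exact: measurable_funepos.
- transitivity (\int[mu]_(x in [set x | setT (x + c)%R]) f^\- (x + c)%R)%E; last first.
    by apply: eq_integral => t _; rewrite !funenegE.
  by apply: ge0_integral_shift => //; exact: measurable_funeneg.
Qed.

Lemma energy_translate (f : R -> R[i]) (k : int) : Cmeasurable f ->
  energy (translate f k) = energy f.
Proof.
move=> mf; rewrite /energy [RHS](integral_shift k%:~R)//.
by apply/measurable_EFinP; exact: measurable_sqn.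
Qed.

Lemma Cmeasurable_translate (f : R -> R[i]) (k : int) : Cmeasurable f ->
  Cmeasurable (translate f k).
Proof.
move=> [mr mi]; split.
- exact: (measurableT_comp mr (measurable_shiftby k%:~R)).
- exact: (measurableT_comp mi (measurable_shiftby k%:~R)).
Qed.

Lemma integrable_translate (f : R -> R) (c : R) :
  mu.-integrable setT (EFin \o f) ->
  mu.-integrable setT (EFin \o (fun x => f (x + c))).
Proof.
move=> /integrableP[mf foo]; apply/integrableP.
have mf' : measurable_fun [set: R] (fun x => f (x + c)).
  move/measurable_EFinP in mf.
  exact: (measurableT_comp mf (measurable_shiftby c)).
split; first exact/measurable_EFinP.
rewrite (_ : integral _ _ _ = \int[mu]_x `|(EFin \o f) x|)%E//.
by rewrite [RHS](integral_shift c)//; exact: measurableT_comp.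
Qed.

End Translation.

(** * Exponentials as Fourier multipliers of translations *)

Section Fourier.
Variable R : realType.
Local Notation mu := (@lebesgue_measure R).
Implicit Types (f g : R -> R[i]) (z w : R[i]).

Lemma CexpiD (a b : R) : Cexpi (a + b) = Cexpi a * Cexpi b.
Proof. by rewrite /Cexpi cosD sinD; congr Complex; rewrite addrC. Qed.

Lemma Cexpi0 : Cexpi (0 : R) = 1.
Proof. by rewrite /Cexpi cos0 sin0. Qed.

Lemma sqn_Cexpi (a : R) : sqn (Cexpi a) = 1.
Proof. exact: cos2Dsin2. Qed.

(** The exponential [E_k] of the overview. *)
Definition character (k : int) (t : R) : R[i] := Cexpi (2 * pi * k%:~R * t).

Lemma characterD (k l : int) t :
  character (k + l) t = character k t * character l t.
Proof. by rewrite /character -CexpiD rmorphD/= mulrDr mulrDl. Qed.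

Lemma character0 t : character 0 t = 1.
Proof. by rewrite /character mulr0 mul0r Cexpi0. Qed.

Lemma sqn_character k t : sqn (character k t) = 1.
Proof. exact: sqn_Cexpi. Qed.

Lemma Cmeasurable_Cexpi_scale (a : R) : Cmeasurable (fun t : R => Cexpi (a * t)).
Proof.
have ma : measurable_fun [set: R] (fun t : R => a * t) by exact: measurable_funM.
split.
- exact: (measurableT_comp (continuous_measurable_fun (@continuous_cos R)) ma).
- exact: (measurableT_comp (continuous_measurable_fun (@continuous_sin R)) ma).
Qed.

Lemma Cmeasurable_character k : Cmeasurable (character k).
Proof. exact: Cmeasurable_Cexpi_scale. Qed.

Definition Cintegrable (D : set R) f : Prop :=
  mu.-integrable D (EFin \o (fun x => complex.Re (f x))) /\
  mu.-integrable D (EFin \o (fun x => complex.Im (f x))).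

Definition Cintegral_on (D : set R) f : R[i] :=
  Complex (\int[mu]_(x in D) complex.Re (f x)) (\int[mu]_(x in D) complex.Im (f x)).

Lemma normc_ge_absRe z : `|complex.Re z| <= Normc.normc z.
Proof.
by case: z => a b /=; rewrite -sqrtr_sqr ler_wsqrtr// lerDl sqr_ge0.
Qed.

Lemma normc_ge_absIm z : `|complex.Im z| <= Normc.normc z.
Proof.
by case: z => a b /=; rewrite -sqrtr_sqr ler_wsqrtr// lerDr sqr_ge0.
Qed.

Lemma normc_le_ReIm z : Normc.normc z <= `|complex.Re z| + `|complex.Im z|.
Proof.
rewrite -ler_sqr ?nnegrE ?normc_ge0 ?addr_ge0// sqn_normc /sqn.
by rewrite sqrrD !real_normK ?num_real// -addrA lerD2l lerDr mulrn_wge0// mulr_ge0.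
Qed.

Lemma measurable_normc f : Cmeasurable f ->
  measurable_fun [set: R] (fun x => Normc.normc (f x)).
Proof.
move=> mf; rewrite (_ : (fun x => _) = (fun x => Num.sqrt (sqn (f x)))).
  apply: measurableT_comp (measurable_sqn mf).
  exact: (continuous_measurable_fun (@sqrt_continuous R)).
by apply/funext => x; rewrite -sqn_normc sqrtr_sqr ger0_norm ?normc_ge0.
Qed.

(** Both directions are domination, since [|Re z|] and [|Im z|] are at most [|z|], which is at most
    [|Re z| + |Im z|]. *)
Lemma CLp1P f : CLp 1%:E f <-> Cintegrable setT f.
Proof.
rewrite /CLp /= /CLnorm Lnorm1; split.
- move=> [mf foo].
  have inc : mu.-integrable setT (EFin \o (fun x => Normc.normc (f x))).
    apply/integrableP; split => //.
    by apply/measurable_EFinP; exact: measurable_normc.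
  split; apply: (le_integrable _ _ _ inc) => //.
  + by apply/measurable_EFinP; case: mf.
  + by move=> x _ /=; rewrite lee_fin [leRHS]ger0_norm ?normc_ge0 ?normc_ge_absRe.
  + by apply/measurable_EFinP; case: mf.
  + by move=> x _ /=; rewrite lee_fin [leRHS]ger0_norm ?normc_ge0 ?normc_ge_absIm.
- move=> [ir ii].
  have mf : Cmeasurable f.
    by split; apply/measurable_EFinP; [case/integrableP: ir|case/integrableP: ii].
  split=> //.
  have := integrableD measurableT (integrable_abse ir) (integrable_abse ii).
  move=> /(le_integrable measurableT _ _) H.
  have /integrableP[//] : mu.-integrable setT (EFin \o (fun x => Normc.normc (f x))).
  apply: H.
    by apply/measurable_EFinP; exact: measurable_normc.
  move=> x _ /=; rewrite lee_fin [leLHS]ger0_norm ?normc_ge0//.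
  by rewrite [leRHS]ger0_norm ?normc_le_ReIm ?addr_ge0.
Qed.

Lemma CintegrableD (D : set (measurableTypeR R)) f g : measurable D ->
  Cintegrable D f -> Cintegrable D g ->
  Cintegrable D (fun x => f x + g x).
Proof.
move=> mD [fr fi] [gr gi]; split.
- apply: (eq_integrable mD _ _ _ (integrableD mD fr gr)) => x _ /=.
  by rewrite raddfD.
- apply: (eq_integrable mD _ _ _ (integrableD mD fi gi)) => x _ /=.
  by rewrite raddfD.
Qed.

Lemma Cintegral_onD (D : set (measurableTypeR R)) f g : measurable D ->
  Cintegrable D f -> Cintegrable D g ->
  Cintegral_on D (fun x => f x + g x) = Cintegral_on D f + Cintegral_on D g.
Proof.
move=> mD [fr fi] [gr gi]; rewrite /Cintegral_on.
rewrite (_ : Complex _ _ + _ = Complex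
  (\int[mu]_(x in D) complex.Re (f x) + \int[mu]_(x in D) complex.Re (g x))
  (\int[mu]_(x in D) complex.Im (f x) + \int[mu]_(x in D) complex.Im (g x)))//.
rewrite -!RintegralD//; congr Complex; apply: eq_Rintegral => x _; by rewrite raddfD.
Qed.

Lemma CintegrableZ (D : set (measurableTypeR R)) z f : measurable D ->
  Cintegrable D f ->
  Cintegrable D (fun x => z * f x).
Proof.
move=> mD [fr fi]; split.
- apply: (eq_integrable mD _ _ _ (integrableB mD
    (integrableZl mD (complex.Re z) fr) (integrableZl mD (complex.Im z) fi))) => x _ /=.
  by rewrite ReM.
- apply: (eq_integrable mD _ _ _ (integrableD mD
    (integrableZl mD (complex.Re z) fi) (integrableZl mD (complex.Im z) fr))) => x _ /=.
  by rewrite ImM.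
Qed.

Lemma integrable_EFinZl (D : set (measurableTypeR R)) (a : R) (u : R -> R) :
  measurable D ->
  mu.-integrable D (EFin \o u) -> mu.-integrable D (EFin \o (fun x => a * u x)).
Proof.
move=> mD iu; apply: (eq_integrable mD _ _ _ (integrableZl mD a iu)).
by move=> x _.
Qed.

Lemma Cintegral_onZ (D : set (measurableTypeR R)) z f : measurable D ->
  Cintegrable D f ->
  Cintegral_on D (fun x => z * f x) = z * Cintegral_on D f.
Proof.
move=> mD [fr fi]; rewrite /Cintegral_on.
case: z => a b.
rewrite (_ : Complex a b * _ = Complex
  (a * \int[mu]_(x in D) complex.Re (f x) - b * \int[mu]_(x in D) complex.Im (f x))
  (a * \int[mu]_(x in D) complex.Im (f x) + b * \int[mu]_(x in D) complex.Re (f x)))//.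
rewrite -!RintegralZl// -RintegralB//; last 2 first.
- exact: integrable_EFinZl.
- exact: integrable_EFinZl.
rewrite -RintegralD//; last 2 first.
- exact: integrable_EFinZl.
- exact: integrable_EFinZl.
by congr Complex; apply: eq_Rintegral => x _; rewrite ?ReM ?ImM.
Qed.

Lemma CintegralD f g : Cintegrable setT f -> Cintegrable setT g ->
  Cintegral (fun x => f x + g x) = Cintegral f + Cintegral g.
Proof. exact: Cintegral_onD. Qed.

Lemma CintegralZ z f : Cintegrable setT f ->
  Cintegral (fun x => z * f x) = z * Cintegral f.
Proof. exact: Cintegral_onZ. Qed.

Lemma CintegrableM_unimodular f g : Cmeasurable g -> (forall x, sqn (g x) = 1) ->
  Cintegrable setT f -> Cintegrable setT (fun x => f x * g x).
Proof.
move=> mg g1 /CLp1P[mf foo]; apply/CLp1P; split; first exact: CmeasurableM.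
rewrite /CLnorm (_ : (fun x => _) = (fun x => (Normc.normc (f x))%:E))//.
apply/funext => x; rewrite Normc.normcM; congr EFin.
by rewrite -[X in _ * X]ger0_norm ?normc_ge0// -sqrtr_sqr sqn_normc g1 sqrtr1 mulr1.
Qed.

Lemma Cintegrable_translate f k : Cintegrable setT f ->
  Cintegrable setT (translate f k).
Proof.
move=> [fr fi]; split.
- exact: (integrable_translate k%:~R fr).
- exact: (integrable_translate k%:~R fi).
Qed.

Lemma Cintegral_shift f (c : R) : Cmeasurable f ->
  Cintegral (fun x => f (x + c)) = Cintegral f.
Proof.
move=> [mr mi]; rewrite /Cintegral /Rintegral; congr (Complex (fine _) (fine _)).
- by rewrite [RHS](integral_shift c)//; exact/measurable_EFinP.
- by rewrite [RHS](integral_shift c)//; exact/measurable_EFinP.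
Qed.

Lemma fourier_kernelE (y : R) : (fun x => Cexpi (- (2 * pi * x * y))) =
  (fun x => Cexpi ((- (2 * pi * y)) * x)).
Proof. by apply/funext => x; congr Cexpi; ring. Qed.

Lemma Cintegrable_fourier f y : Cintegrable setT f ->
  Cintegrable setT (fun x => f x * Cexpi (- (2 * pi * x * y))).
Proof.
move=> fi; apply: CintegrableM_unimodular => //; last by move=> x; exact: sqn_Cexpi.
by rewrite fourier_kernelE; exact: Cmeasurable_Cexpi_scale.
Qed.

Lemma CLp_Cmeasurable p f : CLp p f -> Cmeasurable f. Proof. by case. Qed.

(** Substituting [x + k] for [x] in the right-hand integral produces the factor [e^{-2 pi i k y}],
    which cancels [E_k(y)]. *)
Lemma fourier_translate f k y : Cintegrable setT f ->
  fourier_integral (translate f k) y = character k y * fourier_integral f y.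
Proof.
move=> fi; rewrite /fourier_integral -CintegralZ; last exact: Cintegrable_fourier.
rewrite -[RHS](Cintegral_shift k%:~R); last first.
  exact/(CLp_Cmeasurable (p := 1%:E))/CLp1P
    /(CintegrableZ _ measurableT)/Cintegrable_fourier.
congr Cintegral; apply/funext => x; rewrite /translate mulrCA /character -CexpiD.
by congr (_ * Cexpi _); ring.
Qed.

(** The list holds pairs of a shift and its coefficient; a shift may be repeated, in which case its
    coefficients add up. *)
Definition comb (l : seq (int * R[i])) f x : R[i] :=
  \sum_(q <- l) q.2 * translate f q.1 x.

(** The multiplier by which [comb l] acts on the Fourier side. *)
Definition trigpoly (l : seq (int * R[i])) t : R[i] :=
  \sum_(q <- l) q.2 * character q.1 t.

Lemma Cintegrable_comb l f : Cintegrable setT f -> Cintegrable setT (comb l f).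
Proof.
move=> fi; elim: l => [|q l IH]; rewrite /comb.
  under eq_fun do rewrite big_nil.
  by split; exact: integrable0.
under eq_fun do rewrite big_cons.
by apply: CintegrableD => //; exact/(CintegrableZ _ measurableT)/Cintegrable_translate.
Qed.

Lemma fourier_comb l f y : Cintegrable setT f ->
  fourier_integral (comb l f) y = trigpoly l y * fourier_integral f y.
Proof.
move=> fi; elim: l => [|q l IH].
  rewrite /trigpoly big_nil mul0r /fourier_integral /Cintegral /comb.
  rewrite /Rintegral !integral0_eq// => x _; by rewrite big_nil mul0r.
rewrite /trigpoly big_cons mulrDl -/(trigpoly l y) -IH -mulrA -fourier_translate//.
rewrite /fourier_integral -CintegralZ; last first.
  exact/Cintegrable_fourier/Cintegrable_translate.
rewrite -CintegralD; last 2 first.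
- exact/(CintegrableZ _ measurableT)/Cintegrable_fourier/Cintegrable_translate.
- exact/Cintegrable_fourier/Cintegrable_comb.
congr Cintegral; apply/funext => x; rewrite /comb big_cons mulrDl.
by rewrite mulrA.
Qed.

Lemma Cmeasurable_comb l f : Cmeasurable f -> Cmeasurable (comb l f).
Proof.
move=> mf; apply: Cmeasurable_sum => q; apply: CmeasurableM.
  exact: Cmeasurable_cst.
exact: Cmeasurable_translate.
Qed.

Lemma Cmeasurable_trigpoly l : Cmeasurable (trigpoly l).
Proof.
apply: Cmeasurable_sum => q; apply: CmeasurableM; first exact: Cmeasurable_cst.
exact: Cmeasurable_character.
Qed.

(** The constant obtained by iterating [|a + b|^2 <= 2 |a|^2 + 2 |b|^2] along the list. It bounds
    both the action of [comb l] on energies and the supremum of [|trigpoly l|^2]. *)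
Fixpoint comb_bound (l : seq (int * R[i])) : R :=
  if l is q :: l' then 2 * sqn q.2 + 2 * comb_bound l' else 0.

Lemma comb_bound_ge0 l : 0 <= comb_bound l.
Proof. by elim: l => //= q l IH; rewrite addr_ge0 ?mulr_ge0 ?sqn_ge0. Qed.

Lemma energy_comb_le l f : Cmeasurable f ->
  (energy (comb l f) <= (comb_bound l)%:E * energy f)%E.
Proof.
move=> mf; elim: l => [|q l IH].
  rewrite mul0e /energy integral0_eq// => x _.
  by rewrite /comb big_nil sqn0.
have mt := Cmeasurable_translate q.1 mf.
rewrite [X in energy X](_ : _ =
    (fun x => q.2 * translate f q.1 x + comb l f x)); last first.
  by apply/funext => x; rewrite /comb big_cons.
apply: (le_trans (energyD _ _)).
- by apply: CmeasurableM => //; exact: Cmeasurable_cst.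
- exact: Cmeasurable_comb.
rewrite energyZ// energy_translate//= [X in (_ <= X * _)%E]EFinD.
rewrite ge0_muleDl ?lee_fin ?mulr_ge0 ?sqn_ge0 ?comb_bound_ge0//.
by rewrite muleA -EFinM leeD2l// EFinM -muleA lee_wpmul2l.
Qed.

Lemma sqn_trigpoly_le l t : sqn (trigpoly l t) <= comb_bound l.
Proof.
elim: l => [|q l IH]; first by rewrite /trigpoly big_nil sqn0.
rewrite /trigpoly big_cons (le_trans (sqnD _ _))//= sqnM sqn_character mulr1.
by rewrite lerD2l ler_wpM2l.
Qed.

End Fourier.

(** * Truncation of square-integrable functions *)

Section Isometry.
Variable R : realType.
Local Notation mu := (@lebesgue_measure R).
Implicit Types (f g : R -> R[i]) (z w : R[i]).

Lemma cvge0_eventually_lt (u : nat -> \bar R) : u @ \oo --> 0%E ->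
  forall e : R, 0 < e -> exists N, forall n, (N <= n)%N -> (u n < e%:E)%E.
Proof.
move=> u0 e e0.
have /u0[N _ h] : nbhs (0 : \bar R)%E [set y | (y < e%:E)%E].
  by apply: open_nbhs_nbhs; split; [exact: open_ereal_lt_ereal|rewrite /= lte_fin].
by exists N => n Nn; exact: h.
Qed.

(** Restriction to [[-n, n]]. It brings a function of [L^2] into the intersection of [L^1] and
    [L^2], where the Fourier transform is an integral. *)
Definition cutoff (n : nat) f x : R[i] :=
  Complex (\1_(`[- n%:R, n%:R]%classic : set R) x) 0 * f x.

Lemma Cmeasurable_cutoff n f : Cmeasurable f -> Cmeasurable (cutoff n f).
Proof.
move=> mf; apply: CmeasurableM => //; split; last exact: measurable_cst.
by apply: measurable_indic; exact: measurable_itv.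
Qed.

Lemma sqn_cutoff_le n f x : sqn (cutoff n f x) <= sqn (f x).
Proof.
rewrite sqnM ler_piMl ?sqn_ge0// /sqn /= expr0n addr0 indicE.
by case: (_ \in _); rewrite ?expr1n ?expr0n.
Qed.

Lemma sqn_cutoffB_le n f x : sqn (f x - cutoff n f x) <= sqn (f x).
Proof.
rewrite -[X in X - _]mul1r -mulrBl sqnM ler_piMl ?sqn_ge0//.
rewrite /sqn /= subr0 expr0n addr0 indicE.
by case: (_ \in _); rewrite ?subrr ?subr0 ?expr1n ?expr0n.
Qed.

Lemma integrable_sqn f : CLp 2%:E f ->
  mu.-integrable setT (EFin \o (fun x => sqn (f x))).
Proof.
move=> /CLp2P[mf foo]; apply/integrableP; split.
  by apply/measurable_EFinP; exact: measurable_sqn.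
rewrite (_ : integral _ _ _ = energy f)//; apply: eq_integral => x _ /=.
by rewrite ger0_norm ?sqn_ge0.
Qed.

Lemma cutoff_CLp2 n f : CLp 2%:E f -> CLp 2%:E (cutoff n f).
Proof.
move=> /CLp2P[mf foo]; have mc := Cmeasurable_cutoff n mf.
apply/CLp2P; split=> //; apply: le_lt_trans foo; apply: ge0_le_integral => //.
- by move=> x _; rewrite lee_fin sqn_ge0.
- by apply/measurable_EFinP; exact: measurable_sqn.
- by apply/measurable_EFinP; exact: measurable_sqn.
- by move=> x _; rewrite lee_fin sqn_cutoff_le.
Qed.

(** Since [|b| <= 1 + b^2], the real and imaginary parts are dominated by [1_A + |f|^2], where [A =
    [-n, n]] has finite measure. *)
Lemma cutoff_Cintegrable n f : CLp 2%:E f -> Cintegrable setT (cutoff n f).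
Proof.
move=> f2; have [mf foo] := (CLp2P _).1 f2; have [mr mi] := Cmeasurable_cutoff n mf.
pose A : set R := `[- n%:R, n%:R]%classic.
have mA : measurable A by exact: measurable_itv.
have muA : (mu A < +oo)%E.
  rewrite [X in (X < _)%E](lebesgue_measure_itv `[(- n%:R : R), n%:R])/=.
  by case: ifP => _; rewrite -?EFinB ltry.
have iA : mu.-integrable setT (EFin \o (\1_A : R -> R)).
  apply/integrableP; split; first exact/measurable_EFinP/measurable_indic.
  under eq_integral do rewrite /= ger0_norm//.
  by rewrite integral_indic// setIT.
have iS := integrableD measurableT iA (integrable_sqn f2).
have bound (r b : R) x : `|r| <= `|b| -> b ^+ 2 <= sqn (f x) ->
    `|\1_A x * r| <= `|\1_A x + sqn (f x)|.
  move=> rb bf; have f0 := sqn_ge0 (f x).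
  rewrite indicE; case: (x \in A); rewrite ?mul0r ?normr0// mul1r.
  rewrite mulr1n [leRHS]ger0_norm; last exact: addr_ge0.
  have : `|b| <= 1 + b ^+ 2 by rewrite ler_norml; apply/andP; split; nra.
  lra.
split; apply: (le_integrable measurableT _ _ iS).
- exact/measurable_EFinP.
- move=> x _ /=; rewrite lee_fin ReM /= mul0r subr0.
  by apply: (bound _ (complex.Re (f x))) => //; rewrite /sqn lerDl sqr_ge0.
- exact/measurable_EFinP.
- move=> x _ /=; rewrite lee_fin ImM /= mul0r addr0.
  by apply: (bound _ (complex.Im (f x))) => //; rewrite /sqn lerDr sqr_ge0.
Qed.

(** Dominated convergence with majorant [|f|^2]: at each point [x] the difference is zero as soon as
    [n >= |x|]. *)
Lemma cutoff_cvg f : CLp 2%:E f ->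
  energy (fun x => f x - cutoff n f x) @[n --> \oo] --> 0%E.
Proof.
move=> f2; have [mf foo] := (CLp2P _).1 f2.
have mB n : Cmeasurable (fun x => f x - cutoff n f x).
  by apply: CmeasurableD => //; apply: CmeasurableN; exact: Cmeasurable_cutoff.
have [] := @dominated_convergence _ _ R mu setT measurableT
  (fun n x => (sqn (f x - cutoff n f x))%:E) (cst 0%E) (EFin \o (fun x => sqn (f x))).
- by move=> n; apply/measurable_EFinP; exact: measurable_sqn.
- exact: measurable_cst.
- apply/aeW => x _; apply: cvg_near_cst.
  have [N Nx] : exists N : nat, `|x| <= N%:R.
    by exists (Num.bound `|x|); rewrite ltW// archi_boundP.
  exists N => // n /= Nn; rewrite /cutoff indicE mem_set/= ?mul1r ?subrr ?sqn0//.
  by rewrite in_itv/= -ler_norml (le_trans Nx)// ler_nat.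
- exact: integrable_sqn.
- apply/aeW => x n _ /=; rewrite lee_fin ger0_norm ?sqn_ge0//.
  exact: sqn_cutoffB_le.
by move=> _ _; rewrite integral0.
Qed.

End Isometry.

(** * Energy estimates for the Fourier transform *)

Section FourierBound.
Variable R : realType.
Local Notation mu := (@lebesgue_measure R).
Implicit Types (f g : R -> R[i]).

#[local] Instance ae_lebesgue_filter : Filter (nbhs (almost_everywhere mu)).
Proof. exact: ae_filter_ringOfSetsType. Qed.

Lemma energy_CLnorm2 f : energy f = (CLnorm 2%:E f `^ 2)%E.
Proof.
by rewrite CLnorm2E -poweRrM mulVf// poweRe1// energy_ge0.
Qed.

Lemma CLp2_0 : CLp 2%:E (fun _ : R => 0 : R[i]).
Proof.
apply/CLp2P; split; first exact: Cmeasurable_cst.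
by rewrite /energy integral0_eq// => x _; rewrite sqn0.
Qed.

Lemma Cintegrable0 : Cintegrable setT (fun _ : R => 0 : R[i]).
Proof. by split; exact: integrable0. Qed.

Lemma eq_ae_energy f g : Cmeasurable f -> Cmeasurable g ->
  {ae mu, forall x, f x = g x} -> energy f = energy g.
Proof.
move=> mf mg fg; apply: ae_eq_integral => //.
- by apply/measurable_EFinP; exact: measurable_sqn.
- by apply/measurable_EFinP; exact: measurable_sqn.
by apply: filterS fg => x -> _.
Qed.

Section Bound.
Variable F : (R -> R[i]) -> (R -> R[i]).
Hypothesis hF : is_L2_fourier F.

Lemma fourier_energyB f g : CLp 2%:E f -> CLp 2%:E g ->
  energy (fun x => F f x - F g x) = energy (fun x => f x - g x).
Proof.
case: hF => _ iso _ f2 g2.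
by rewrite !energy_CLnorm2; congr (_ `^ 2)%E; exact: iso.
Qed.

(** The isometry hypothesis speaks of distances. Measuring the distance to [F 0], which is zero
    almost everywhere as the Fourier integral of 0, turns it into a statement on norms. *)
Lemma fourier_energy f : CLp 2%:E f -> energy (F f) = energy f.
Proof.
move=> f2; have [hF2 _ hF3] := hF.
have [mf _] := (CLp2P _).1 f2.
have [mFf _] := (CLp2P _).1 (hF2 _ f2).
have [mF0 _] := (CLp2P _).1 (hF2 _ CLp2_0).
transitivity (energy (fun x => F f x - F (fun _ => 0) x)); last first.
  rewrite fourier_energyB//; last exact: CLp2_0.
  by congr energy; apply/funext => x; rewrite subr0.
apply: eq_ae_energy => //; first by apply: CmeasurableD => //; exact: CmeasurableN.
have := hF3 _ ((CLp1P _).2 Cintegrable0) CLp2_0.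
apply: filterS => y ->.
rewrite /fourier_integral /Cintegral /Rintegral !integral0_eq//; last 2 first.
- by move=> x _; rewrite mul0r.
- by move=> x _; rewrite mul0r.
by rewrite [Complex _ _](_ : _ = 0)// subr0.
Qed.

Lemma comb_CLp2 l f : CLp 2%:E f -> CLp 2%:E (comb l f).
Proof.
move=> /CLp2P[mf foo]; apply/CLp2P; split; first exact: Cmeasurable_comb.
apply: le_lt_trans (energy_comb_le l mf) _.
by rewrite lte_mul_pinfty// lee_fin comb_bound_ge0.
Qed.

(** For integrable [f] both transforms are Fourier integrals almost everywhere, so the multiplier
    identity holds under [F]. *)
Lemma fourier_comb_energy l f : CLp 1%:E f -> CLp 2%:E f ->
  energy (fun y => trigpoly l y * F f y) = energy (comb l f).
Proof.
move=> f1 f2; have [hF2 _ hF3] := hF.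
have cf2 := comb_CLp2 l f2.
have cf1 : CLp 1%:E (comb l f) by apply/CLp1P/Cintegrable_comb/CLp1P.
rewrite -(fourier_energy cf2).
have [mFf _] := (CLp2P _).1 (hF2 _ f2).
have [mFc _] := (CLp2P _).1 (hF2 _ cf2).
apply: eq_ae_energy => //.
  by apply: CmeasurableM => //; exact: Cmeasurable_trigpoly.
have := hF3 _ f1 f2; have := hF3 _ cf1 cf2; apply: filterS2 => y -> ->.
by rewrite fourier_comb//; exact/CLp1P.
Qed.

Lemma combB l f g x : comb l (fun x => f x - g x) x = comb l f x - comb l g x.
Proof.
by rewrite /comb -sumrB; apply: eq_bigr => q _; rewrite /translate mulrBr.
Qed.

(** The multiplier identity is available for the cutoffs of [phi]; the isometry controls the error
    on both sides, and this error tends to 0. *)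
Lemma trigpoly_fourier_energy_le l phi : CLp 2%:E phi ->
  (energy (fun y => trigpoly l y * F phi y)%R <= 4%:E * energy (comb l phi))%E.
Proof.
move=> phi2; have [hF2 _ hF3] := hF.
have [mphi _] := (CLp2P _).1 phi2.
have [mF _] := (CLp2P _).1 (hF2 _ phi2).
have mp := Cmeasurable_trigpoly l.
pose K := comb_bound l; have K0 : 0 <= K := comb_bound_ge0 l.
pose err n := energy (fun x => phi x - cutoff n phi x).
(* The inequality with factor 2 is used twice, which gives the 4. The error enters as [2 * (2 * K)]
   through the combinations and as [2 * K] through the transforms, hence [6 * K]. *)
have step n : (energy (fun y => trigpoly l y * F phi y)%R <=
    4%:E * energy (comb l phi) + (6 * K)%:E * err n)%E.
  have psi2 := cutoff_CLp2 n phi2.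
  have psi1 := (CLp1P _).2 (cutoff_Cintegrable n phi2).
  have [mpsi _] := (CLp2P _).1 psi2.
  have [mFpsi _] := (CLp2P _).1 (hF2 _ psi2).
  have mB : Cmeasurable (fun x => phi x - cutoff n phi x).
    by apply: CmeasurableD => //; exact: CmeasurableN.
  have mFB : Cmeasurable (fun x => F phi x - F (cutoff n phi) x).
    by apply: CmeasurableD => //; exact: CmeasurableN.
  have h1 : (energy (fun y => trigpoly l y * F phi y)%R <=
      2%:E * energy (fun y => trigpoly l y * F (cutoff n phi) y)%R +
      2%:E * energy (fun y => trigpoly l y * (F phi y - F (cutoff n phi) y))%R)%E.
    rewrite [X in (energy X <= _)%E](_ : _ = (fun y =>
       trigpoly l y * F (cutoff n phi) y +
       trigpoly l y * (F phi y - F (cutoff n phi) y))); last first.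
      by apply/funext => y; rewrite mulrBr addrC subrK.
    by apply: energyD; exact: CmeasurableM.
  have h2 : (energy (comb l (cutoff n phi)) <=
      2%:E * energy (comb l phi) + 2%:E * (K%:E * err n))%E.
    rewrite [X in (energy X <= _)%E](_ : _ = (fun y => comb l phi y +
       - comb l (fun x => phi x - cutoff n phi x) y)); last first.
      by apply/funext => y; rewrite combB opprB addrC subrK.
    apply: (le_trans (energyD _ _)).
    - exact: Cmeasurable_comb.
    - exact/CmeasurableN/Cmeasurable_comb.
    rewrite leeD2l// lee_wpmul2l//.
    rewrite (_ : energy _ = energy (comb l (fun x => phi x - cutoff n phi x))).
      exact: energy_comb_le.
    by apply: eq_integral => y _; rewrite sqnN.
  have h3 : (energy (fun y => trigpoly l y * (F phi y - F (cutoff n phi) y))%R <=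
      K%:E * err n)%E.
    rewrite /err -fourier_energyB//; apply: energyM_le => //.
    exact: sqn_trigpoly_le.
  apply: (le_trans h1).
  rewrite (fourier_comb_energy l psi1 psi2).
  apply: (le_trans (leeD (lee_wpmul2l _ h2) (lee_wpmul2l _ h3))) => //.
  have e0 := energy_ge0 (comb l phi).
  have r0 : (0 <= err n)%E := energy_ge0 _.
  rewrite ge0_muleDr ?mule_ge0// ?lee_fin// !muleA -!EFinM -addeA.
  rewrite -ge0_muleDl ?lee_fin ?mulr_ge0//.
  by rewrite -EFinD; apply: leeD; rewrite lee_wpmul2r// lee_fin; nra.
apply/lee_addgt0Pr => e e0.
(* The added 1 keeps the divisor positive when [K = 0]. *)
have K1 : 0 < 6 * K + 1 by rewrite ltr_wpDl// mulr_ge0.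
have [N hN] := cvge0_eventually_lt (cutoff_cvg phi2) (divr_gt0 e0 K1).
apply: (le_trans (step N)); rewrite leeD2l//.
apply: (le_trans (lee_wpmul2l _ (ltW (hN N (leqnn N))))).
  by rewrite lee_fin mulr_ge0.
rewrite -EFinM lee_fin mulrCA ger_pMr// ler_pdivrMr// mul1r lerDl//.
Qed.

End Bound.
End FourierBound.

(** * Periodization *)

Section Periodization.
Variable R : realType.
Local Notation mu := (@lebesgue_measure R).
Implicit Types (g : R -> R[i]).

(** An enumeration of the integers, even indices giving the nonnegative ones and odd indices the
    negative ones. It turns the sum over the integers into a series over [nat], which can be
    exchanged with the integral. *)
Definition int_of_nat (n : nat) : int :=
  if odd n then Negz n./2 else Posz n./2.

Lemma int_of_nat_bij : set_bij [set: nat] [set: int] int_of_nat.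
Proof.
split=> //.
- move=> m n _ _; rewrite /int_of_nat.
  move=> mn; rewrite -[m]odd_double_half -[n]odd_double_half.
  by move: mn; case: (odd m); case: (odd n) => // -[->].
- move=> [k|k] _.
    by exists k.*2 => //; rewrite /int_of_nat odd_double doubleK.
  by exists k.*2.+1 => //; rewrite /int_of_nat /= odd_double/= uphalf_double.
Qed.

Lemma int_shift_bij (k : int) : set_bij [set: int] [set: int] (fun j => j + k).
Proof.
split=> //; first by move=> m n _ _ /addIr.
by move=> j _; exists (j - k) => //; rewrite subrK.
Qed.

Lemma periodization_nneseries g t : periodization g t =
  (\sum_(n <oo) (sqn (g (t + (int_of_nat n)%:~R)%R))%:E)%E.
Proof.
rewrite /periodization (reindex_esum _ _ _ _ int_of_nat_bij) -nneseries_esumT.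
  by apply: eq_eseriesr => n _; rewrite sqn_normc.
by move=> n; rewrite lee_fin sqr_ge0.
Qed.

Lemma periodization_ge0 g t : (0 <= periodization g t)%E.
Proof. by apply: esum_ge0 => k _; rewrite lee_fin sqr_ge0. Qed.

Lemma periodizationD g t (k : int) :
  periodization g (t + k%:~R) = periodization g t.
Proof.
rewrite /periodization [RHS](reindex_esum _ _ _ _ (int_shift_bij k)).
by apply: eq_esum => j _; rewrite rmorphD/= -addrA [k%:~R + _]addrC.
Qed.

Lemma measurable_sqn_shift g (c : R) : Cmeasurable g ->
  measurable_fun [set: R] (fun t => (sqn (g (t + c)))%:E).
Proof.
move=> mg; apply/measurable_EFinP.
exact: (measurableT_comp (measurable_sqn mg) (measurable_shiftby c)).
Qed.

Lemma measurable_periodization g : Cmeasurable g ->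
  measurable_fun [set: R] (periodization g).
Proof.
move=> mg; rewrite (_ : periodization g = (fun t =>
    \sum_(n <oo | n \in predT) (sqn (g (t + (int_of_nat n)%:~R)%R))%:E)%E); last first.
  by apply/funext => t; rewrite periodization_nneseries.
apply: ge0_emeasurable_sum => [n t _ _|n _]; first by rewrite lee_fin sqn_ge0.
exact: measurable_sqn_shift.
Qed.

Lemma bigcup_unit_itv :
  \bigcup_n (`[(int_of_nat n)%:~R, (int_of_nat n)%:~R + 1[%classic : set R) = setT.
Proof.
apply/seteqP; split=> // t _.
have [_ _ sur] := int_of_nat_bij.
have [n _ En] := sur (Num.floor t) I.
exists n => //=; rewrite in_itv/= En.
exact: mem_rg1_floor.
Qed.

Lemma trivIset_unit_itv :
  trivIset setT (fun n =>
    `[(int_of_nat n)%:~R, (int_of_nat n)%:~R + 1[%classic : set R).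
Proof.
move=> m n _ _ [t []] /=; rewrite !in_itv/= => /andP[m1 m2] /andP[n1 n2].
have [_ inj _] := int_of_nat_bij.
apply: inj => //; rewrite ?inE//.
have fl (k : int) : k%:~R <= t -> t < k%:~R + 1 -> Num.floor t = k.
  by move=> k1 k2; apply/floor_def; rewrite k1 rmorphD.
by rewrite -(fl _ m1 m2) -(fl _ n1 n2).
Qed.

(** Cut the line into unit cells, shift each cell to [[0, 1)], where the periodic [p] is unchanged,
    and exchange sum and integral of nonnegative terms. *)
Lemma energy_periodization (p g : R -> R[i]) : Cmeasurable p -> Cmeasurable g ->
  (forall t (k : int), p (t + k%:~R) = p t) ->
  energy (fun t => p t * g t) =
  (\int[mu]_(t in `[0%R, 1%R[) ((sqn (p t))%:E * periodization g t))%E.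
Proof.
move=> mp mg per.
have mpg : Cmeasurable (fun t => p t * g t) by exact: CmeasurableM.
rewrite /energy -bigcup_unit_itv ge0_integral_bigcup//=; last 3 first.
- apply: measurable_funTS; apply/measurable_EFinP; exact: measurable_sqn.
- by move=> t _; rewrite lee_fin sqn_ge0.
- exact: trivIset_unit_itv.
transitivity (\sum_(n <oo) \int[mu]_(t in `[0%R, 1%R[)
   ((sqn (p t))%:E * (sqn (g (t + (int_of_nat n)%:~R)%R))%:E))%E.
  apply: eq_eseriesr => n _.
  rewrite [LHS](ge0_integral_shift (int_of_nat n)%:~R)//; last 2 first.
  - apply: measurable_funTS; apply/measurable_EFinP; exact: measurable_sqn.
  - by move=> t _; rewrite lee_fin sqn_ge0.
  rewrite (_ : [set x | _] = `[0%R, 1%R[%classic); last first.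
    by apply/seteqP; split=> t /=; rewrite !in_itv/= lerDr [_ + 1]addrC ltrD2r.
  by apply: eq_integral => t _; rewrite sqnM per EFinM.
rewrite -integral_nneseries//; last 2 first.
- move=> n; apply: measurable_funTS; apply: emeasurable_funM.
    by apply/measurable_EFinP; exact: measurable_sqn.
  exact: measurable_sqn_shift.
- by move=> n t _; rewrite mule_ge0// lee_fin sqn_ge0.
apply: eq_integral => t _; rewrite periodization_nneseries nneseriesZl//.
by move=> n _; rewrite lee_fin sqn_ge0.
Qed.

Lemma Cexpi_2pi_int (k : int) : Cexpi (2 * pi * k%:~R) = 1 :> R[i].
Proof.
have Cexpi_nat (n : nat) : Cexpi (2 * pi * n%:R) = 1 :> R[i].
  have -> : 2 * pi * n%:R = 0 + (pi *+ 2) *+ n :> R.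
    by rewrite add0r mulr_natr mulr2n mulrDl mul1r.
  by rewrite /Cexpi (periodicn (@cosD2pi R)) (periodicn (@sinD2pi R)) cos0 sin0.
case: k => [n|n]; first exact: Cexpi_nat.
rewrite NegzE rmorphN mulrN -[LHS]mulr1 -[X in _ * X](Cexpi_nat n.+1) -CexpiD.
by rewrite addNr Cexpi0.
Qed.

Lemma character_periodic k t (j : int) :
  character k (t + j%:~R) = character k t :> R[i].
Proof.
by rewrite /character mulrDr CexpiD -[_ * j%:~R]mulrA -rmorphM/= Cexpi_2pi_int mulr1.
Qed.

Lemma trigpoly_periodic l t (j : int) :
  trigpoly l (t + j%:~R) = trigpoly l t :> R[i].
Proof. by apply: eq_bigr => q _; rewrite character_periodic. Qed.

End Periodization.

(** * Reciprocal weights and local integrability *)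

Section Weight.
Variable R : realType.
Local Notation mu := (@lebesgue_measure R).

(** Away from the values 0 and [+oo], which are split off, the inverse is the power of exponent
    -1. *)
Lemma measurable_inve (w : R -> \bar R) : measurable_fun [set: R] w ->
  (forall t, (0 <= w t)%E) -> measurable_fun [set: R] (fun t => (w t)^-1)%E.
Proof.
move=> mw w0.
rewrite (_ : (fun t => _) = (fun t => if w t == 0%E then +oo%E else
  if w t == +oo%E then 0%E else (w t `^ (-1))%E)); last first.
  apply/funext => t; have := w0 t; case: (w t) => [r| |]//=.
  rewrite lee_fin => r0; rewrite inver eqe; case: ifP => // rn0.
  by rewrite powR_inv1.
apply: measurable_fun_ifT.
- exact: measurable_fun_eqe.
- exact: measurable_cst.
apply: measurable_fun_ifT.
- exact: measurable_fun_eqe.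
- exact: measurable_cst.
exact: (measurableT_comp (measurable_poweR (-1)) mw).
Qed.

Lemma integral_setU_lty (A B : set R) (f : R -> \bar R) :
  measurable A -> measurable B -> measurable_fun [set: R] f -> (forall t, 0 <= f t)%E ->
  (\int[mu]_(t in A) f t < +oo -> \int[mu]_(t in B) f t < +oo ->
   \int[mu]_(t in A `|` B) f t < +oo)%E.
Proof.
move=> mA mB mf f0 fA fB.
have mBA : measurable (B `\` A) by exact: measurableD.
have -> : A `|` B = A `|` (B `\` A) by rewrite setUDr setDv setD0.
rewrite ge0_integral_setU//; last 2 first.
- exact: measurable_funTS.
- by apply/disj_setPS => t [At [_]].
rewrite lte_add_pinfty// (le_lt_trans _ fB)//.
by apply: ge0_subset_integral => //; exact: measurable_funTS.
Qed.

(** By compactness finitely many of the given neighbourhoods cover [[a, b]], and the integral over a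
    finite union is finite. *)
Lemma integral_lty_locally (f : R -> \bar R) (a b : R) :
  measurable_fun [set: R] f -> (forall t, 0 <= f t)%E ->
  (forall t : R, exists2 r : R, 0 < r & (\int[mu]_(u in centered t r) f u < +oo)%E) ->
  (\int[mu]_(t in `[a, b]) f t < +oo)%E.
Proof.
move=> mf f0 loc.
pose r t := projT1 (cid2 (loc t)).
have r0 t : 0 < r t by rewrite /r; case: cid2.
have fr t : (\int[mu]_(u in centered t (r t)) f u < +oo)%E by rewrite /r; case: cid2.
have := @segment_compact R a b; rewrite compact_cover.
move=> /(_ R setT (fun t => centered t (r t))) [t _|t _|X _ Xab].
- exact: interval_open.
- by exists t => //; rewrite /centered /= in_itv/= ltrBlDr !ltrDl r0.
move: Xab; rewrite /cover bigcup_fset => Xab.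
have mU l : measurable (\big[setU/set0]_(i <- l) centered i (r i)).
  by apply: bigsetU_measurable => t _; exact: measurable_itv.
apply: (@le_lt_trans _ _
    (\int[mu]_(t in \big[setU/set0]_(i <- finmap.enum_fset X) centered i (r i)) f t)%E).
  apply: ge0_subset_integral => //; [exact: mU|exact: measurable_funTS].
elim: (finmap.enum_fset X) => [|t l IH].
  by rewrite big_nil integral_set0.
rewrite big_cons; apply: integral_setU_lty => //; exact: measurable_itv.
Qed.

End Weight.

(** * Pairing trigonometric polynomials with test functions *)

Section Orthogonality.
Variable R : realType.
Local Notation mu := (@lebesgue_measure R).

Lemma Rintegral01_derive (f G : R -> R) : continuous f ->
  (forall t : R, is_derive t 1 G (f t)) ->
  \int[mu]_(t in `[0%R, 1%R[) f t = G 1 - G 0.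
Proof.
move=> cf dG.
have cG : continuous G.
  by move=> t; apply/differentiable_continuous/derivable1_diffP; have [] := dG t.
rewrite /Rintegral integral_itv_bndo_bndc; last first.
  apply: measurable_funTS; apply/measurable_EFinP; exact: continuous_measurable_fun.
rewrite (@continuous_FTC2 _ f G)//.
- exact: continuous_subspaceT.
- split.
  + by move=> t _; have [] := dG t.
  + exact/cvg_at_right_filter/cG.
  + exact/cvg_at_left_filter/cG.
- by move=> t _; rewrite derive1E; have [_ ->] := dG t.
Qed.

Lemma is_derive_scale (c t : R) : is_derive t 1 (fun u : R => c * u) c.
Proof.
have := @is_deriveZ R R R id c t 1 1 (is_derive_id _ _).
by rewrite -[_ *: _]/(c * 1) mulr1.
Qed.

Lemma is_derive_sin_scale (c t : R) : c != 0 ->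
  is_derive t 1 (fun u => c^-1 * sin (c * u)) (cos (c * t)).
Proof.
move=> c0.
have h : is_derive t 1 (sin \o (fun u => c * u)) (cos (c * t) * c).
  by apply: is_derive1_comp; exact: is_derive_scale.
have := @is_deriveZ R R R _ c^-1 t 1 _ h.
by rewrite -[_ *: _]/(_ * _) [X in c^-1 * X]mulrC mulKf.
Qed.

Lemma is_derive_cos_scale (c t : R) : c != 0 ->
  is_derive t 1 (fun u => - c^-1 * cos (c * u)) (sin (c * t)).
Proof.
move=> c0.
have h : is_derive t 1 (cos \o (fun u => c * u)) (- sin (c * t) * c).
  by apply: is_derive1_comp; exact: is_derive_scale.
have := @is_deriveZ R R R _ (- c^-1) t 1 _ h.
by rewrite -[_ *: _]/(_ * _) mulNr mulNr mulrN opprK [X in c^-1 * X]mulrC mulKf.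
Qed.

(** For [k != 0] and [c = 2 pi k], the antiderivatives [sin (c t) / c] and [- cos (c t) / c] take
    equal values at 0 and 1. *)
Lemma integral_character (k : int) :
  Cintegral_on `[0%R, 1%R[ (@character R k) = (k == 0)%:R.
Proof.
have [->|k0] := eqVneq k 0.
  rewrite /Cintegral_on.
  have -> : \int[mu]_(x in `[0%R, 1%R[) complex.Re (character 0 x) = 1.
    rewrite (@eq_Rintegral _ _ _ mu _ (fun=> 1)); last by move=> t _; rewrite character0.
    by rewrite (@Rintegral01_derive _ id) ?subr0// => t; exact: cst_continuous.
  have -> : \int[mu]_(x in `[0%R, 1%R[) complex.Im (character 0 x) = 0.
    rewrite (@eq_Rintegral _ _ _ mu _ (fun=> 0)); last by move=> t _; rewrite character0.
    rewrite (@Rintegral01_derive _ (fun=> 0)) ?subr0// => t; exact: cst_continuous.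
  by [].
set c := 2 * pi * k%:~R : R.
have c0 : c != 0 by rewrite !mulf_neq0 ?intr_eq0// gt_eqF// pi_gt0.
have cc : continuous (fun t : R => c * t).
  move=> t; apply/differentiable_continuous/derivable1_diffP.
  by have [] := is_derive_scale c t.
have := Cexpi_2pi_int R k; rewrite -/c => -[cosc sinc].
have ccos : continuous (fun t : R => cos (c * t)).
  by move=> t; apply: continuous_comp; [exact: cc|exact: continuous_cos].
have csin : continuous (fun t : R => sin (c * t)).
  by move=> t; apply: continuous_comp; [exact: cc|exact: continuous_sin].
have := Rintegral01_derive ccos (fun t => is_derive_sin_scale t c0).
have := Rintegral01_derive csin (fun t => is_derive_cos_scale t c0).
rewrite !mulr1 !mulr0 sinc cosc sin0 cos0 !mulr0 !subrr => Is Ic.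
by rewrite /Cintegral_on; congr Complex; [exact: Ic|exact: Is].
Qed.

End Orthogonality.

Section Pairing.
Variable R : realType.
Local Notation mu := (@lebesgue_measure R).
Local Notation I01 := (`[0%R, 1%R[%classic : set (measurableTypeR R)).
Implicit Types (f g : R -> R[i]) (l : seq (int * R[i])) (ws : seq R[i]).

Definition Cbounded f : Prop := Cmeasurable f /\ exists C : R, forall t, sqn (f t) <= C.

Lemma CboundedD f g : Cbounded f -> Cbounded g -> Cbounded (fun t => f t + g t).
Proof.
move=> [mf [C fC]] [mg [D gD]]; split; first exact: CmeasurableD.
by exists (2 * C + 2 * D) => t; rewrite (le_trans (sqnD _ _))// lerD// ler_wpM2l.
Qed.

Lemma CboundedM f g : Cbounded f -> Cbounded g -> Cbounded (fun t => f t * g t).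
Proof.
move=> [mf [C fC]] [mg [D gD]]; split; first exact: CmeasurableM.
by exists (C * D) => t; rewrite sqnM ler_pM ?sqn_ge0.
Qed.

Lemma Cbounded_cst (z : R[i]) : Cbounded (fun _ => z).
Proof. by split; [exact: Cmeasurable_cst|exists (sqn z)]. Qed.

Lemma Cbounded_character k : Cbounded (@character R k).
Proof.
by split; [exact: Cmeasurable_character|exists 1 => t; rewrite sqn_character].
Qed.

Lemma Cbounded_trigpoly l : Cbounded (trigpoly l).
Proof.
by split; [exact: Cmeasurable_trigpoly|exists (comb_bound l); exact: sqn_trigpoly_le].
Qed.

Lemma Cbounded_integrable f : Cbounded f -> Cintegrable I01 f.
Proof.
move=> [[mr mi] [C fC]].
have C0 : 0 <= C by exact: le_trans (sqn_ge0 (f 0)) (fC 0).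
have bnd (u : R -> R) : measurable_fun [set: R] u -> (forall t, u t ^+ 2 <= C) ->
    mu.-integrable I01 (EFin \o u).
  move=> mu_ uC; apply: measurable_bounded_integrable => //.
  - rewrite [X in (X < _)%E](lebesgue_measure_itv `[0%R, 1%R[)/=.
    by case: ifP => _; rewrite -?EFinB ltry.
  - exact: measurable_funTS.
  (* From [u^2 <= C] follows [|u| <= 1 + C], without extracting a root. *)
  - exists (1 + C); split; first exact: num_real.
    move=> M CM t _ /=; apply: (le_trans _ (ltW CM)).
    by rewrite ler_norml; have := uC t => ut; apply/andP; split; nra.
split; apply: bnd => // t; apply: le_trans (fC t); rewrite /sqn.
- by rewrite lerDl sqr_ge0.
- by rewrite lerDr sqr_ge0.
Qed.

(** The function [h] of the overview, its roots listed with multiplicity in [ws]. The frequencies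
    are negative because the pairing below is bilinear, without conjugation. *)
Definition test (a : int) ws (t : R) : R[i] :=
  character (- a) t * \prod_(w <- ws) (character (-1) t - w).

(** Multiplication by [E_{-1}] raises [a] by 1, so test functions obey the recursion that defines
    [difference]. *)
Lemma test_cons a w ws t : test a (w :: ws) t = test (a + 1) ws t - w * test a ws t.
Proof. by rewrite /test big_cons opprD characterD; ring. Qed.

Lemma Cbounded_test a ws : Cbounded (test a ws).
Proof.
elim: ws a => [|w ws IH] a.
  rewrite (_ : test a [::] = character (- a)); first exact: Cbounded_character.
  by apply/funext => t; rewrite /test big_nil mulr1.
rewrite (_ : test a (w :: ws) = fun t => test (a + 1) ws t + (- w) * test a ws t).
  by apply: CboundedD => //; apply: CboundedM => //; exact: Cbounded_cst.
by apply/funext => t; rewrite test_cons mulNr.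
Qed.

Lemma test_periodic a ws t (k : int) : test a ws (t + k%:~R) = test a ws t.
Proof.
rewrite /test character_periodic; congr (_ * _).
by apply: eq_bigr => w _; rewrite character_periodic.
Qed.

Definition pairing l a ws : R[i] :=
  Cintegral_on I01 (fun t => trigpoly l t * test a ws t).

Definition coefficient l (a : int) : R[i] := \sum_(q <- l) q.2 * (q.1 == a)%:R.

(** Orthogonality: the integral of [E_k E_{-a}] over a period is 1 if [k = a] and 0 otherwise. *)
Lemma pairing_nil l a : pairing l a [::] = coefficient l a.
Proof.
rewrite /pairing /coefficient.
rewrite (_ : (fun t => _) =
    (fun t => \sum_(q <- l) q.2 * character (q.1 - a) t)); last first.
  apply/funext => t; rewrite /test big_nil mulr1 /trigpoly big_distrl.
  by apply: eq_bigr => q _; rewrite characterD mulrA.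
elim: l => [|q l IH].
  rewrite big_nil (_ : (fun t => _) = (fun t => 0 * 0)); last first.
    by apply/funext => t; rewrite big_nil mul0r.
  rewrite (@Cintegral_onZ R I01 0 (fun _ => 0)) ?mul0r//.
  exact/Cbounded_integrable/Cbounded_cst.
rewrite (_ : (fun t => _) = (fun t => q.2 * character (q.1 - a) t +
    \sum_(q <- l) q.2 * character (q.1 - a) t)); last first.
  by apply/funext => t; rewrite big_cons.
have iq : Cintegrable I01 (character (q.1 - a)).
  exact/Cbounded_integrable/Cbounded_character.
rewrite Cintegral_onD//; last 2 first.
- exact: CintegrableZ.
- apply: Cbounded_integrable.
  rewrite (_ : (fun t => _) = trigpoly [seq (q.1 - a, q.2) | q <- l]).
    exact: Cbounded_trigpoly.
  by apply/funext => t; rewrite /trigpoly big_map.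
by rewrite IH Cintegral_onZ// integral_character subr_eq0 big_cons.
Qed.

Lemma pairing_cons l a w ws :
  pairing l a (w :: ws) = pairing l (a + 1) ws - w * pairing l a ws.
Proof.
have ib b : Cintegrable I01 (fun t => trigpoly l t * test b ws t).
  apply/Cbounded_integrable/CboundedM; first exact: Cbounded_trigpoly.
  exact: Cbounded_test.
rewrite /pairing -mulNr -Cintegral_onZ// -Cintegral_onD//; last exact: CintegrableZ.
by congr Cintegral_on; apply/funext => t; rewrite test_cons; ring.
Qed.

Lemma pairing_difference l a ws : pairing l a ws = difference ws (coefficient l) a.
Proof.
elim: ws a => [|w ws IH] a; first exact: pairing_nil.
by rewrite pairing_cons !IH.
Qed.

(* Also valid at [w = 0] and [w = +oo], by the conventions [0^-1 = +oo],
   [+oo^-1 = 0] and [0 * +oo = 0]. *)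
Lemma weighted_AMGM (c x y z : R) (w : \bar R) : 0 < c -> 0 <= y -> 0 <= z ->
  x ^+ 2 <= y * z -> (0 <= w)%E ->
  (`|x|%:E <= c%:E * (y%:E * w) + c^-1%:E * (z%:E / w))%E.
Proof.
move=> c0 y0 z0 xyz; have ci0 : 0 < c^-1 by rewrite invr_gt0.
have x0_of0 : y * z = 0 -> x = 0.
  by move=> yz0; apply/eqP; rewrite -sqrf_eq0 eq_le sqr_ge0 -yz0 xyz.
case: w => [r|_|//]; last first.
  have [y00|yn0] := eqVneq y 0.
    by rewrite x0_of0 ?y00 ?mul0r// normr0 invey mul0e !mule0 add0e.
  have y1 : (0 < y%:E)%E by rewrite lte_fin lt_def yn0.
  by rewrite invey mule0 mule0 adde0 gt0_muley// gt0_muley// leey.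
rewrite lee_fin le_eqVlt => /predU1P[<-|r0].
  have [z00|zn0] := eqVneq z 0.
    by rewrite x0_of0 ?z00 ?mulr0// normr0 mule0 mule0 add0e mul0e mule0.
  have z1 : (0 < z%:E)%E by rewrite lte_fin lt_def zn0.
  by rewrite inve0 !mule0 add0e gt0_muley// gt0_muley// leey.
rewrite inver gt_eqF// -!EFinM -EFinD lee_fin.
have A0 : 0 <= c * (y * r) by rewrite !mulr_ge0// ltW.
have B0 : 0 <= c^-1 * (z / r) by rewrite !mulr_ge0 ?invr_ge0// ltW.
rewrite -ler_sqr ?nnegrE ?addr_ge0// real_normK ?num_real//.
(* The parameter cancels in the product, so [x^2 <= A B <= (A + B)^2] for the two summands [A] and
   [B]. *)
have AB : (c * (y * r)) * (c^-1 * (z / r)) = y * z.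
  by field; rewrite !gt_eqF.
by apply: (le_trans xyz); rewrite -AB; nra.
Qed.

(** A form of the Cauchy-Schwarz inequality with a free parameter [c], obtained by integrating
    [weighted_AMGM] pointwise for the real and imaginary parts. *)
Lemma pairing_le l a ws (c : R) (w : R -> \bar R) : 0 < c ->
  measurable_fun [set: R] w -> (forall t, 0 <= w t)%E ->
  let bound := (c%:E * \int[mu]_(t in I01) ((sqn (trigpoly l t))%:E * w t) +
    c^-1%:E * \int[mu]_(t in I01) ((sqn (test a ws t))%:E / w t))%E in
  (`|complex.Re (pairing l a ws)|%:E <= bound)%E /\
  (`|complex.Im (pairing l a ws)|%:E <= bound)%E.
Proof.
move=> c0 mw w0 bound.
have mwi := measurable_inve mw w0.
have [mp _] := Cbounded_trigpoly l; have [mt _] := Cbounded_test a ws.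
have : Cintegrable I01 (fun t => trigpoly l t * test a ws t).
  apply/Cbounded_integrable/CboundedM; first exact: Cbounded_trigpoly.
  exact: Cbounded_test.
have gen (u : R -> R) : measurable_fun [set: R] u -> mu.-integrable I01 (EFin \o u) ->
    (forall t, u t ^+ 2 <= sqn (trigpoly l t) * sqn (test a ws t)) ->
    (`|\int[mu]_(t in I01) u t|%:E <= bound)%E.
  move=> mu_ iu ub.
  have m1 : measurable_fun I01 (fun t => (sqn (trigpoly l t))%:E * w t)%E.
    apply: measurable_funTS; apply: emeasurable_funM => //.
    by apply/measurable_EFinP; exact: measurable_sqn.
  have m2 : measurable_fun I01 (fun t => (sqn (test a ws t))%:E / w t)%E.
    apply: measurable_funTS; apply: emeasurable_funM => //.
    by apply/measurable_EFinP; exact: measurable_sqn.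
  have n1 t : (0 <= (sqn (trigpoly l t))%:E * w t)%E.
    by rewrite mule_ge0// lee_fin sqn_ge0.
  have n2 t : (0 <= (sqn (test a ws t))%:E / w t)%E.
    by rewrite mule_ge0 ?inve_ge0// lee_fin sqn_ge0.
  have c1 : (0 <= c%:E)%E by rewrite lee_fin ltW.
  have c2 : (0 <= c^-1%:E)%E by rewrite lee_fin invr_ge0 ltW.
  rewrite /bound -ge0_integralZl// -ge0_integralZl//.
  rewrite -ge0_integralD//; last 4 first.
  - by move=> t _; rewrite mule_ge0.
  - exact: emeasurable_funM.
  - by move=> t _; rewrite mule_ge0.
  - exact: emeasurable_funM.
  rewrite /Rintegral -abse_EFin fineK; last exact: integrable_fin_num.
  apply: (le_trans (le_abse_integral _ _ _)) => //.
    by apply/measurable_EFinP; exact: measurable_funTS.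
  apply: ge0_le_integral => //.
  - by apply: measurableT_comp => //; apply/measurable_EFinP; exact: measurable_funTS.
  - by apply: emeasurable_funD; exact: emeasurable_funM.
  - by move=> t _ /=; apply: weighted_AMGM => //; exact: sqn_ge0.
move=> [ir ii]; split; apply: gen => //.
- by case: (CmeasurableM mp mt).
- by move=> t; rewrite -sqnM /sqn lerDl sqr_ge0.
- by case: (CmeasurableM mp mt).
- by move=> t; rewrite -sqnM /sqn lerDr sqr_ge0.
Qed.

(** First [c] is taken large to make the test-function term small, then [l] is chosen with weighted
    norm small relative to [c]; the pairing stays equal to [v] throughout. *)
Lemma pairing_limit0 a ws (v : R[i]) (w : R -> \bar R) :
  measurable_fun [set: R] w -> (forall t, 0 <= w t)%E ->
  (\int[mu]_(t in I01) ((sqn (test a ws t))%:E / w t) < +oo)%E ->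
  (forall e : R, 0 < e -> exists2 l, pairing l a ws = v &
     (\int[mu]_(t in I01) ((sqn (trigpoly l t))%:E * w t) < e%:E)%E) ->
  v = 0.
Proof.
move=> mw w0 Boo H.
set B := (\int[mu]_(t in I01) _)%E in Boo.
have B0 : (0 <= B)%E.
  by apply: integral_ge0 => t _; rewrite mule_ge0 ?inve_ge0// lee_fin sqn_ge0.
have [b Bb] : exists b : R, B = b%:E.
  by exists (fine B); rewrite fineK// ge0_fin_numE.
have b0 : 0 <= b by rewrite -lee_fin -Bb.
have gen (d : R) : 0 < d -> `|complex.Re v| < d /\ `|complex.Im v| < d.
  (* With this [c] the second term is [d b / (2 (b + 1)) < d / 2]; using [b + 1] keeps [c] positive
     when [b = 0]. *)
  move=> d0; pose c := 2 * (b + 1) / d.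
  have c0 : 0 < c by rewrite divr_gt0// mulr_gt0// ltr_wpDl.
  have [l lv lt] := H (d / 2 / c) (divr_gt0 (divr_gt0 d0 (ltr0Sn _ 1)) c0).
  have := pairing_le l a ws c0 mw w0; rewrite lv -/B Bb.
  set A := (\int[mu]_(t in I01) _)%E in lt *.
  have bd : (c%:E * A + c^-1%:E * b%:E < d%:E)%E.
    have -> : d = d / 2 + d / 2 by field.
    rewrite EFinD lteD//.
      rewrite -(lte_pdivlMl _ _ c0) -EFinM mulrC //.
    rewrite -EFinM lte_fin /c invf_div mulrAC ltr_pdivrMr ?mulr_gt0 ?ltr_wpDl//.
    nra.
  move=> [h1 h2]; split; rewrite -lte_fin.
  - exact: le_lt_trans h1 bd.
  - exact: le_lt_trans h2 bd.
have z0 (r : R) : (forall d, 0 < d -> `|r| < d) -> r = 0.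
  move=> h; apply/eqP; rewrite -normr_eq0 eq_le normr_ge0 andbT leNgt.
  by apply/negP => /h; rewrite ltxx.
have hr : complex.Re v = 0 by apply: z0 => d /gen[].
have hi : complex.Im v = 0 by apply: z0 => d /gen[].
by case: v hr hi {H gen} => /= ? ? -> ->.
Qed.

End Pairing.

(** * Test functions vanishing at the singularities *)

Section Roots.
Variable R : realType.
Local Notation mu := (@lebesgue_measure R).

Lemma lipschitz1_of_derive (f df : R -> R) :
  (forall t : R, is_derive t 1 f (df t)) -> (forall t, `|df t| <= 1) ->
  forall a b, `|f a - f b| <= `|a - b|.
Proof.
move=> fd df1 a b; wlog ab : a b / a <= b.
  by move=> W; have [|/ltW] := leP a b => ab; [|rewrite distrC [leRHS]distrC]; exact: W.
have cf : continuous f.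
  by move=> t; apply/differentiable_continuous/derivable1_diffP; have [] := fd t.
have [|c _ E] := @MVT_segment R f df a b ab (fun t _ => fd t).
  exact: continuous_subspaceT.
by rewrite distrC [leRHS]distrC E normrM ler_piMl.
Qed.

(** Cosine and sine are both 1-Lipschitz, and each contributes one [(a - b)^2]. *)
Lemma sqn_CexpiB_le (a b : R) : sqn (Cexpi a - Cexpi b) <= 2 * (a - b) ^+ 2.
Proof.
rewrite /sqn /= mulr2n mulrDl mul1r -[(a - b) ^+ 2]real_normK ?num_real//.
apply: lerD; rewrite -[leLHS]real_normK ?num_real// ler_sqr ?nnegrE//.
- apply: (lipschitz1_of_derive (f := cos) (df := - sin)) => t.
  by rewrite normrN sin_max.
- apply: (lipschitz1_of_derive (f := sin) (df := cos)) => t.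
  exact: cos_max.
Qed.

Lemma sqn_prod (I : Type) (l : seq I) (P : pred I) (f : I -> R[i]) :
  sqn (\prod_(i <- l | P i) f i) = \prod_(i <- l | P i) sqn (f i).
Proof.
elim/big_rec2: _ => [|i r z _ <-]; last exact: sqnM.
by rewrite /sqn /= expr1n expr0n addr0.
Qed.

Lemma sqnX (z : R[i]) n : sqn (z ^+ n) = sqn z ^+ n.
Proof.
elim: n => [|n IH]; first by rewrite !expr0 /sqn /= expr1n expr0n addr0.
by rewrite !exprS sqnM IH.
Qed.

Variables (s : nat) (x : 'I_s -> R) (lambda : 'I_s -> nat).

(** Each [w_j = E_{-1}(x_j)] is repeated [lambda j] times, so that the test function vanishes at
    [x j] to order [lambda j]. *)
Definition roots : seq R[i] :=
  flatten [seq nseq (lambda j) (character (-1) (x j)) | j <- enum 'I_s].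

Lemma normc_root : {in roots, forall w, Normc.normc w = 1}.
Proof.
move=> w /flatten_mapP[j _] /nseqP[-> _].
by rewrite -[LHS]ger0_norm ?normc_ge0// -sqrtr_sqr sqn_normc sqn_character sqrtr1.
Qed.

Lemma prod_roots t : \prod_(w <- roots) (character (-1) t - w) =
  \prod_j (character (-1) t - character (-1) (x j)) ^+ lambda j.
Proof.
rewrite big_flatten big_map big_enum; apply: eq_bigr => j _.
by rewrite big_nseq iter_mulr_1.
Qed.

Lemma sqn_test_near_root a j : exists2 C : R, 0 <= C & forall t,
  sqn (test a roots t) <= C * (t - x j) ^+ (2 * lambda j).
Proof.
(* A difference of two unimodular numbers has squared modulus at most 4, which bounds the factors
   with [i != j]. The factor of index [j] is bounded through the Lipschitz estimate, whence
   [2 (2 pi)^2]. *)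
pose M := \prod_(i | i != j) 4 ^+ lambda i : R.
exists ((2 * (2 * pi) ^+ 2) ^+ lambda j * M).
  rewrite mulr_ge0//; last by rewrite prodr_ge0// => i _; rewrite exprn_ge0.
  by rewrite exprn_ge0// mulr_ge0// sqr_ge0.
move=> t; rewrite sqnM sqn_character mul1r prod_roots sqn_prod (bigD1 j)//=.
rewrite mulrAC exprM -exprMn; apply: ler_pM.
- exact: sqn_ge0.
- by apply: prodr_ge0 => i _; exact: sqn_ge0.
- rewrite sqnX lerXn2r ?nnegrE ?sqn_ge0//.
    by rewrite -mulrA -exprMn mulr_ge0// sqr_ge0.
  rewrite (le_trans (sqn_CexpiB_le _ _))// rmorphN1.
  by rewrite -mulrBr exprMn !mulrN1 sqrrN mulrA.
- apply: ler_prod => i _; rewrite sqn_ge0 sqnX lerXn2r ?nnegrE ?sqn_ge0//.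
  by rewrite (le_trans (sqnD _ _))// sqnN !sqn_character; lra.
Qed.

Variable w : R -> \bar R.
Hypotheses (mw : measurable_fun [set: R] w) (w0 : forall t, (0 <= w t)%E).
Hypothesis wper : forall t (k : int), w (t + k%:~R) = w t.
Hypothesis hsing : forall j, exists2 r : R, 0 < r &
  mu.-integrable (centered (x j) r) (fun t => ((t - x j) ^+ (2 * lambda j))%:E / w t)%E.
Hypothesis honly : forall t : R, (forall j, t - x j \isn't a Num.int) ->
  locally_integrable_at (fun u => (w u)^-1)%E t.

(** Near a translate of some [x j] the zero of the test function compensates the singularity; near
    any other point [1 / w] is integrable and the test function is bounded. Compactness combines
    these local bounds. *)
Lemma test_weight_lty a :
  (\int[mu]_(t in `[0%R, 1%R[) ((sqn (test a roots t))%:E / w t) < +oo)%E.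
Proof.
have mwi := measurable_inve mw w0.
have [mt [C tC]] := Cbounded_test a roots.
have C0 : 0 <= C by exact: le_trans (sqn_ge0 _) (tC 0).
pose G t : \bar R := ((sqn (test a roots t))%:E / w t)%E.
have mG : measurable_fun [set: R] G.
  apply: emeasurable_funM => //.
  by apply/measurable_EFinP; exact: measurable_sqn.
have G0 t : (0 <= G t)%E by rewrite mule_ge0 ?inve_ge0// lee_fin sqn_ge0.
have Gle (D : R) (A : set R) (h : R -> \bar R) : 0 <= D -> measurable A ->
    mu.-integrable A h -> (forall t, 0 <= h t)%E -> (forall t, G t <= D%:E * h t)%E ->
    (\int[mu]_(t in A) G t < +oo)%E.
  move=> D0 mA ih h0 Gh; have [mh _] := integrableP _ _ _ ih.
  apply: (@le_lt_trans _ _ (D%:E * \int[mu]_(t in A) h t)%E); last first.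
    by rewrite lte_mul_pinfty// integrable_lty.
  rewrite -ge0_integralZl//.
  apply: ge0_le_integral => //; first exact: measurable_funTS.
  exact: emeasurable_funM.
(* The interval is closed up to make it compact. *)
apply: (@le_lt_trans _ _ (\int[mu]_(t in `[0%R, 1%R]) G t)%E).
  apply: ge0_subset_integral => //; first exact: measurable_funTS.
    by move=> t _; exact: G0.
  exact: subset_itv_co_cc.
apply: integral_lty_locally => // t.
have [[j tj]|tx] := pselect (exists j, t - x j \is a Num.int); last first.
  have tx' j : t - x j \isn't a Num.int by apply/negP => tj; apply: tx; exists j.
  have [r r0 ir] := honly tx'.
  exists r => //; apply: (Gle C _ _ C0 _ ir) => [|u|u].
  - exact: measurable_itv.
  - by rewrite inve_ge0.
  - by rewrite /G lee_wpmul2r ?inve_ge0// lee_fin.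
have [r r0 ir] := hsing j; exists r => //.
(* The point [t] is an integer translate of [x j]; by periodicity the integral is moved back to the
   neighbourhood of [x j]. *)
have [k tk] := intrP tj.
have -> : t = x j + k%:~R by rewrite -tk addrC subrK.
have [D D0 tD] := sqn_test_near_root a j.
rewrite [X in (X < _)%E](ge0_integral_shift k%:~R)//; last 2 first.
- exact: measurable_itv.
- exact: measurable_funTS.
rewrite (_ : [set u | _] = centered (x j) r); last first.
  apply/seteqP; split => u /=; rewrite /centered /= !in_itv/=.
    by move=> /andP[h1 h2]; apply/andP; split; lra.
  by move=> /andP[h1 h2]; apply/andP; split; lra.
rewrite [X in (X < _)%E](_ : _ = (\int[mu]_(u in centered (x j) r) G u)%E); last first.
  by apply: eq_integral => u _; rewrite /G test_periodic wper.
apply: (Gle D _ _ D0 _ ir) => [|u|u].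
- exact: measurable_itv.
- by rewrite mule_ge0 ?inve_ge0// lee_fin exprM exprn_ge0// sqr_ge0.
- by rewrite muleA -EFinM lee_wpmul2r ?inve_ge0// lee_fin.
Qed.

End Roots.

(** * Expansions of a translate *)

Section Expansion.
Variable R : realType.

Lemma energy_lt_of_CLnorm2 (g : R -> R[i]) (e : R) : 0 < e ->
  (CLnorm 2%:E g < (e `^ 2^-1)%:E)%E -> (energy g < e%:E)%E.
Proof.
move=> e0; rewrite !ltNge; apply: contra => eg.
rewrite CLnorm2E -poweR_EFin; apply: gt0_ler_poweR => //.
- by rewrite in_itv/= lee_fin (ltW e0) leey.
- by rewrite in_itv/= energy_ge0 leey.
Qed.

Variables (phi : R -> R[i]) (sigma : nat -> int) (m : int) (c : nat -> R[i]).
Hypothesis hphi : CLp 2%:E phi.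
Hypothesis sigma_inj : injective sigma.
Hypothesis sigma_neq : forall n, sigma n != m.
Hypothesis hc : L2dist (translate phi m)
  (fun x => \sum_(n < N) c n * translate phi (sigma n) x) @[N --> \oo] --> 0%E.

(** The coefficients of the remainder of the expansion after [N] terms. *)
Definition residual N : seq (int * R[i]) :=
  (m, 1) :: [seq (sigma n, - c n) | n <- iota 0 N].

Lemma comb_residual N x : comb (residual N) phi x =
  translate phi m x - \sum_(n < N) c n * translate phi (sigma n) x.
Proof.
rewrite /comb big_cons mul1r big_map; congr (_ + _).
rewrite -(big_mkord xpredT (fun n => c n * translate phi (sigma n) x)).
by rewrite -sumrN /index_iota subn0; apply: eq_bigr => n _; rewrite mulNr.
Qed.

Lemma energy_residual (e : R) : 0 < e -> exists N0, forall N, (N0 <= N)%N ->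
  (energy (comb (residual N) phi) < e%:E)%E.
Proof.
move=> e0; have [N0 h] := cvge0_eventually_lt hc (powR_gt0 2^-1 e0).
exists N0 => N /h; rewrite /L2dist => H; apply: energy_lt_of_CLnorm2 => //.
by rewrite (_ : comb _ _ = (fun x => translate phi m x -
  \sum_(n < N) c n * translate phi (sigma n) x)) //; apply/funext; exact: comb_residual.
Qed.

(** Two consecutive remainders differ by [c n] times a translate of [phi], whose energy is [|c n|^2]
    times that of [phi], and both remainders tend to 0. *)
Lemma expansion_coeff_cvg0 : energy phi != 0%E -> forall e : R, 0 < e ->
  exists N0, forall n, (N0 <= n)%N -> sqn (c n) < e.
Proof.
have [mphi phioo] := (CLp2P _).1 hphi.
move=> E0; have [E Ephi] : exists E : R, energy phi = E%:E.
  by exists (fine (energy phi)); rewrite fineK// ge0_fin_numE// energy_ge0.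
have Epos : 0 < E.
  rewrite lt_def; have := energy_ge0 phi; rewrite Ephi lee_fin => ->.
  by move: E0; rewrite Ephi eqe andbT.
move=> e e0.
(* With remainders below [e E / 4], the factors 2 for the difference add up to [e E]. *)
have [N0 hN] := energy_residual (divr_gt0 (mulr_gt0 e0 Epos) (ltr0Sn R 3)).
exists N0 => n Nn.
have h1 := hN n Nn; have h2 := hN n.+1 (leqW Nn).
have mr N : Cmeasurable (comb (residual N) phi) by exact: Cmeasurable_comb.
have := energyD (mr n) (CmeasurableN (mr n.+1)).
rewrite (_ : (fun x => _ + _) = (fun x => c n * translate phi (sigma n) x)); last first.
  by apply/funext => x; rewrite !comb_residual big_ord_recr/=; ring.
rewrite energyZ; last exact: Cmeasurable_translate.
rewrite energy_translate// Ephi.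
rewrite (_ : energy (fun x => - _) = energy (comb (residual n.+1) phi)); last first.
  by apply: eq_integral => x _; rewrite sqnN.
move=> h; rewrite -(ltr_pM2r Epos) -lte_fin EFinM (le_lt_trans h)//.
have -> : e * E = 2 * (e * E / 4) + 2 * (e * E / 4) by field.
by rewrite [ltRHS]EFinD lteD// EFinM lte_pmul2l.
Qed.

(** The sequence [d] of the overview; an index [n] with [sigma n = a] is chosen classically, and it
    is unique as [sigma] is injective. *)
Definition limit_coeff (a : int) : R[i] :=
  if pselect (exists n, sigma n = a) is left h then - c (projT1 (cid h))
  else (m == a)%:R.

Lemma coefficient_residual N a : coefficient (residual N) a =
  (m == a)%:R - \sum_(n < N) c n * (sigma n == a)%:R.
Proof.
rewrite /coefficient big_cons mul1r big_map; congr (_ + _).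
rewrite -(big_mkord xpredT (fun n => c n * (sigma n == a)%:R)).
by rewrite -sumrN /index_iota subn0; apply: eq_bigr => n _; rewrite mulNr.
Qed.

(** If [a = sigma n], the coefficient at [a] is settled from [N = n + 1] on; if [a] is not a value
    of [sigma], it never changes. *)
Lemma coefficient_eventually a : exists N0, forall N, (N0 <= N)%N ->
  coefficient (residual N) a = limit_coeff a.
Proof.
rewrite /limit_coeff; case: pselect => [h|h].
  case: cid => n /= sna; exists n.+1 => N nN.
  rewrite coefficient_residual (bigD1 (Ordinal nN))//= sna eqxx mulr1 big1 ?addr0.
    by rewrite -sna eq_sym (negbTE (sigma_neq n)) sub0r.
  move=> i; rewrite -val_eqE/= => ni; rewrite -sna (inj_eq sigma_inj) (negbTE ni).
  by rewrite mulr0.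
exists 0%N => N _; rewrite coefficient_residual big1 ?subr0// => n _.
by case: eqP => [sna|]; rewrite ?mulr0//; case: h; exists n.
Qed.

Lemma limit_coeff_vanishes : energy phi != 0%E -> vanishes_at_pinfty limit_coeff.
Proof.
move=> E0 e e0; have [N0 hN] := expansion_coeff_cvg0 E0 (exprn_gt0 2 e0).
(* This threshold exceeds [m] and every [sigma n] with [n < N0], so a nonzero coefficient beyond it
   comes from some [c n] with [n >= N0]. *)
exists (1 + `|m| + \sum_(n < N0) `|sigma n|) => k Kk; rewrite /limit_coeff.
case: pselect => [h|_].
  case: cid => n /= snk; rewrite normcN.
  rewrite -ltr_sqr ?nnegrE ?normc_ge0 ?(ltW e0)// sqn_normc hN// leqNgt.
  apply/negP => nN0; move: Kk; rewrite -snk (bigD1 (Ordinal nN0))//=.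
  have S0 : 0 <= \sum_(i < N0 | i != Ordinal nN0) `|sigma i| by exact: sumr_ge0.
  by move: (\sum_(_ < N0 | _) _) (sigma n) S0 => S sn; lia.
have S0 : 0 <= \sum_(i < N0) `|sigma i| by exact: sumr_ge0.
case: eqP => [mk|_]; last by rewrite Normc.normc0.
by exfalso; move: (\sum_(_ < N0) _) S0 Kk => S; rewrite -mk; lia.
Qed.

Lemma limit_coeff_m : limit_coeff m = 1.
Proof.
rewrite /limit_coeff; case: pselect => [h|_]; last by rewrite eqxx.
by exfalso; case: h => n /eqP; exact/negP.
Qed.

End Expansion.

(** * Contradiction from the expansion of an omitted translate *)

Theorem proposition4 (R : realType)
  (F : (R -> R[i]) -> (R -> R[i])) (hF : is_L2_fourier F)
  (phi : R -> R[i]) (hphi : CLp 2%:E phi)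
  (s : nat) (x : 'I_s -> R) (lambda : 'I_s -> nat)
  (hdistinct : forall i j : 'I_s, i != j -> x i - x j \isn't a Num.int)
  (hsing : forall j : 'I_s, has_singularity (periodization (F phi)) (lambda j) (x j))
  (honly : forall t : R, (forall j : 'I_s, t - x j \isn't a Num.int) ->
     locally_integrable_at (fun u => (periodization (F phi) u)^-1)%E t)
  (hLambda : (1 <= \sum_(j < s) lambda j)%N)
  (Omega : set int)
  (hOmega : consecutive_integers Omega (\sum_(j < s) lambda j)%N)
  (sigma : nat -> int) (hsigma : set_bij [set: nat] (~` Omega) sigma) :
  ~ schauder_basis (closed_span_translates phi)
      (fun n => translate phi (sigma n)).
Proof.
move=> [_ hbasis].
have [mphi phioo] := (CLp2P _).1 hphi.
(* The assumption [|Lambda| >= 1] makes [Omega] nonempty. *)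
have [m Om] : exists m, Omega m.
  by case: hOmega => m ->; exists m => /=; rewrite lexx ltrDl ltz_nat.
have [sfun sinj _] := hsigma.
have sigma_inj : injective sigma by move=> i j ij; apply: sinj; rewrite ?inE.
have sigma_neq n : sigma n != m.
  by apply/negP => /eqP snm; apply: (sfun n I); rewrite snm.
have Sm : closed_span_translates phi (translate phi m).
  split.
    apply/CLp2P; split; first exact: Cmeasurable_translate.
    by rewrite energy_translate.
  move=> e e0; exists [:: m], (fun=> 1).
  rewrite /L2dist CLnorm2E (_ : energy _ = 0%E) ?poweR0r ?lte_fin ?invr_neq0//.
  by apply: integral0_eq => t _; rewrite big_seq1 mul1r subrr sqn0.
have [c [hc cuniq]] := hbasis _ Sm.
(* If [phi] vanished almost everywhere, every sequence would expand its translate, and the constant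
   sequences 0 and 1 would contradict uniqueness. *)
have E0 : energy phi != 0%E.
  apply/negP => /eqP phi0.
  have all_expand (d : nat -> R[i]) : L2dist (translate phi m)
      (fun t => \sum_(n < N) d n * translate phi (sigma n) t) @[N --> \oo] --> 0%E.
    apply: cvg_near_cst; apply: nearW => N.
    rewrite /L2dist (_ : (fun t => _) = comb (residual sigma m d N) phi); last first.
      by apply/funext => t; rewrite comb_residual.
    rewrite CLnorm2E (_ : energy _ = 0%E) ?poweR0r ?invr_neq0//.
    apply/eqP; rewrite eq_le energy_ge0 andbT.
    by rewrite (le_trans (energy_comb_le _ mphi))// phi0 mule0.
  have := cuniq _ (all_expand (fun=> 0)); rewrite (cuniq _ (all_expand (fun=> 1))).
  by move=> /(congr1 (fun d => d 0%N)) /eqP; rewrite oner_eq0.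
have [mF _] : CLp 2%:E (F phi) by case: hF => h _ _; exact: h.
have mw := measurable_periodization mF.
have w0 := periodization_ge0 (F phi).
have hsing' j : exists2 r : R, 0 < r &
    (@lebesgue_measure R).-integrable (centered (x j) r)
    (fun t => ((t - x j) ^+ (2 * lambda j))%:E / periodization (F phi) t)%E.
  by case: (hsing j) => _ [r [r0 _ ir]]; exists r.
pose d := limit_coeff sigma m c.
(* The roots are unimodular and [d] vanishes at [+oo], so it suffices that the iterated difference
   of [d] is zero everywhere. At each [a] this value is the pairing of all late remainders with a
   fixed test function. *)
have d0 : forall a, d a = 0.
  apply: (difference_eq0 (@normc_root _ _ x lambda)).
    exact: (limit_coeff_vanishes hphi hc E0).
  move=> a; apply: (pairing_limit0 mw w0 (a := a) (ws := roots x lambda)).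
    by apply: test_weight_lty => // t k; exact: periodizationD.
  move=> e e0.
  have [N1 h1] := difference_eventually_eq (roots x lambda)
    (coefficient_eventually c sigma_inj sigma_neq) a.
  (* The tolerance [e / 4] absorbs the factor 4 of [trigpoly_fourier_energy_le]. *)
  have [N2 h2] := energy_residual hc (divr_gt0 e0 (ltr0Sn R 3)).
  pose N := maxn N1 N2.
  exists (residual sigma m c N); first by rewrite pairing_difference h1// leq_maxl.
  rewrite -energy_periodization//; last 2 first.
  - exact: Cmeasurable_trigpoly.
  - exact: trigpoly_periodic.
  apply: (le_lt_trans (trigpoly_fourier_energy_le hF _ hphi)).
  have := h2 N (leq_maxr _ _); rewrite -(@lte_pmul2l R 4%:E)// => h.
  by apply: (lt_le_trans h); rewrite -EFinM lee_fin mulrC divfK.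
by have := limit_coeff_m c sigma_neq; rewrite -/d d0 => /eqP; rewrite eq_sym oner_eq0.
Qed.
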